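(* Let $(\Gamma,X)$ be a finite-state faithful self-similar group. Then the $\mathrm C^*$-algebra $\mathrm C^*_{\mathrm{ess}}(K(\Gamma,X))$ admits a unique tracial state.
   Context: Self-similar groups. $X$ is a finite set with $|X|\ge2$ and $X^*$ is the set of finite words on $X$ (including the empty word), viewed as a rooted tree in which $w$ and $wx$ are joined by an edge for $w\in X^*$, $x\in X$. For an automorphism $\varphi$ of the rooted tree $X^*$ and $w\in X^*$, $\varphi|_w$ is the automorphism with $\varphi(wv)=\varphi(w)\varphi|_w(v)$ for all $v\in X^*$; $\varphi$ is finite-state if $\{\varphi|_w\mid w\in X^*\}$ is finite. $\varphi$ induces a homeomorphism of $X^{\mathbb N}$ (the space of infinite words, with the product topology), again denoted $\varphi$, with $\varphi(w)_{[1,n]}=\varphi(w_{[1,n]})$ for all $n$. A faithful self-similar group $(\Gamma,X)$ is a faithful action of a group $\Gamma$ by automorphisms on $X^*$ such that $g|_v\in\Gamma$ for all $g\in\Gamma$, $v\in X^*$; it is finite-state if each $g\in\Gamma$ is finite-state. The groupoid $K(\Gamma,X)$. For $u,v\in X^*$ with $|u|=|v|$ and $g\in\Gamma$ let $g_{u,v}\colon vX^{\mathbb N}\to uX^{\mathbb N}$, $g_{u,v}(vw)=ug(w)$. $K(\Gamma,X)$ is the groupoid of germs of the pseudogroup $S=\{g_{u,v}\mid g\in\Gamma,\ u,v\in X^*,\ |u|=|v|\}$ on $X^{\mathbb N}$ (the empty map may be added; it contributes no germs). Here the groupoid of germs of a pseudogroup $(S,Y)$ ($S$ a set of homeomorphisms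 between open subsets of a locally compact Hausdorff space $Y$, closed under composition and inversion, whose domains cover $Y$) is the set of classes $[s,x]$ with $s\in S$, $x\in\operatorname{dom}s$, where $[s,x]=[t,y]$ iff $x=y$ and $s,t$ agree on a neighbourhood of $x$ contained in $\operatorname{dom}s\cap\operatorname{dom}t$; product $[t,sx][s,x]=[ts,x]$, inverse $[s,x]^{-1}=[s^{-1},sx]$; the topology has basis $\Theta(s,U)=\{[s,x]\mid x\in U\}$, $s\in S$, $U\subset\operatorname{dom}s$ open. It is étale (its range and source maps are local homeomorphisms), not necessarily Hausdorff, with unit space identified with $Y$. Algebra. For an étale groupoid $G$ with locally compact Hausdorff unit space $G^0$ (but $G$ not necessarily Hausdorff), $\mathcal C_c(G)$ is the linear span of the functions on $G$ that are continuous with compact support on some open Hausdorff subset $U\subset G$ and zero outside $U$, with $(ab)(g)=\sum_{g_1g_2=g}a(g_1)b(g_2)$ and $a^*(g)=\overline{a(g^{-1})}$. $\mathrm C^*(G)$ is the completion of $\mathcal C_c(G)$ in the supremum of all $\mathrm C^*$-seminorms. Let $B_\infty(G^0)$ be the bounded Borel functions on $G^0$ and $M(G^0)\subset B_\infty(G^0)$ the functions vanishing off a meagre set. There is a contractive positive linear map $E\colon\mathrm C^*(G)\to B_\infty(G^0)$ with $E(a)=a|_{G^0}$ for $a\in\mathcal C_c(G)$; $J=\{a\in\mathrm C^*(G)\mid E(a^*a)\in M(G^0)\}$ is a closed ideal and $\mathrm C^*_{\mathrm{ess}}(G)=\mathrm C^*(G)/J$. A tracial state is a state $\tau$ with $\tau(ab)=\tau(ba)$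 for all $a,b$. *)

(* Defs.v *)
From HB Require Import structures.
From mathcomp Require Import all_boot all_order all_algebra.
From mathcomp Require Import all_classical all_reals all_analysis.
From mathcomp Require Import complex.

Set Implicit Arguments.
Unset Strict Implicit.
Unset Printing Implicit Defensive.

Import Order.TTheory GRing.Theory Num.Theory.
Import numFieldNormedType.Exports.

Local Open Scope classical_set_scope.

Section Pseudogroup.
Variable Y : topologicalType.

(* A partial map of Y is a function [s : Y -> option Y] with domain
   [s x <> None], so that equality of partial maps is Leibniz equality. *)
Definition pdom (s : Y -> option Y) : set Y := [set x | s x <> None].

Definition pcomp (t s : Y -> option Y) : Y -> option Y := fun x => obind t (s x).

Definition pinverse (s t : Y -> option Y) :=
  forall x y, s x = Some y <-> t y = Some x.

Record pseudogroup := Pseudogroup {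
  pg_maps : set (Y -> option Y);
  (* with [V = setT] this says that the domain of [s] is open *)
  pg_continuous : forall s, pg_maps s -> forall V : set Y, open V ->
    open [set x | exists2 y, s x = Some y & V y];
  pg_comp : forall s t, pg_maps s -> pg_maps t -> pg_maps (pcomp t s);
  pg_inv : forall s, pg_maps s -> exists2 t, pg_maps t & pinverse s t;
  pg_cover : forall x, exists2 s, pg_maps s & pdom s x
}.

End Pseudogroup.

Section Germ.
Variables (Y : topologicalType) (P : pseudogroup Y).
Local Notation S := (pg_maps P).

(* The class [s, x], encoded as the pair of x and of the set of all t in S
   that agree with s on a neighbourhood of x contained in both domains. *)
Definition germ_class (s : Y -> option Y) (x : Y) : Y * set (Y -> option Y) :=
  (x, [set t | S t /\ \forall y \near x, s y <> None /\ t y = s y]).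

Definition germ_classes : set (Y * set (Y -> option Y)) :=
  [set c | exists s x, [/\ S s, pdom s x & c = germ_class s x]].

Definition germ := set_type germ_classes.
HB.instance Definition _ := Choice.on germ.

Definition is_germ (c : germ) s x :=
  [/\ S s, pdom s x & set_val c = germ_class s x].

Definition theta (i : (Y -> option Y) * set Y) : set germ :=
  [set c | exists2 x, i.2 x & is_germ c i.1 x].

Definition theta_index : set ((Y -> option Y) * set Y) :=
  [set i | [/\ S i.1, open i.2 & i.2 `<=` pdom i.1]].

Lemma is_germ_ex (c : germ) : exists s x, is_germ c s x.
Proof. by have := set_valP c => -[s [x [Ss sx e]]]; exists s, x; split. Qed.

Lemma open_pdom s : S s -> open (pdom s).
Proof.
move=> Ss; have := pg_continuous Ss openT; congr open.
apply/seteqP; split => x /=; first by move=> [y e _]; rewrite /pdom /= e.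
by rewrite /pdom /=; case: (s x) => // y _; exists y.
Qed.

Lemma near_pdom s x : S s -> pdom s x -> \forall y \near x, s y <> None.
Proof. by move=> Ss sx; apply: open_nbhs_nbhs; split => //; exact: open_pdom. Qed.

Lemma germ_class_eq s t x : S s -> S t -> pdom s x ->
  germ_class s x = germ_class t x -> \forall y \near x, s y <> None /\ t y = s y.
Proof.
move=> Ss St sx [e]; have : [set t | S t /\ \forall y \near x, s y <> None /\ t y = s y] s.
  by split => //; apply: filterS (near_pdom Ss sx) => y.
rewrite e /= => -[_ H]; apply: filterS H => y [ty ->]; split => //.
Qed.

Lemma germ_classE s t x : (\forall y \near x, s y <> None /\ t y = s y) ->
  germ_class s x = germ_class t x.
Proof.
move=> H; congr pair; apply/seteqP; split => r /= -[Sr Hr]; split => //.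
  by apply: filterS2 H Hr => y [sy ->] [_ ->].
by apply: filterS2 H Hr => y [sy e] [ty ->]; rewrite e.
Qed.

Lemma theta_cover : \bigcup_(i in theta_index) theta i = setT.
Proof.
apply/seteqP; split => // c _; have [s [x [Ss sx e]]] := is_germ_ex c.
exists (s, pdom s); first by split => //=; exact: open_pdom.
by exists x.
Qed.

Lemma theta_join i j c : theta_index i -> theta_index j ->
  theta i c -> theta j c ->
  exists k, [/\ theta_index k, theta k c & theta k `<=` theta i `&` theta j].
Proof.
case: i j => [s U] [t V] [/= Ss oU Us] [/= St oV Vt].
move=> [x /= Ux [_ sx es]] [x' /= Vx [_ tx et]].
have xx' : x' = x by have := esym es; rewrite et => /(congr1 fst).
subst x'.
have /(germ_class_eq Ss St sx) : germ_class s x = germ_class t x by rewrite -es.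
move=> /nbhs_interior; set W := (W in W^°) => Wx.
exists (s, U `&` V `&` W^°); split => /=.
- split => //=; last by move=> y [[/Us]].
  by apply: openI; [exact: openI|exact: open_interior].
- by exists x => //; split; [split|exact: nbhs_singleton].
- move=> d [y [[/= Uy Vy] Wy] [_ sy ed]]; split; exists y => //.
  by split => //; [exact: Vt|rewrite ed; exact: germ_classE].
Qed.

HB.instance Definition _ := isBaseTopological.Build germ theta_cover theta_join.

Definition germ_source (c : germ) : Y := (set_val c).1.

Definition is_unit_germ (x : Y) (c : germ) :=
  exists2 s, is_germ c s x & \forall y \near x, s y = Some y.

(* [germ_prod c2 c1 c]: c2 and c1 are composable and c2 c1 = c *)
Definition germ_prod (c2 c1 c : germ) := exists t s x y,
  [/\ is_germ c1 s x, s x = Some y, is_germ c2 t y & is_germ c (pcomp t s) x].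

Definition is_inverse_germ (c d : germ) := exists s t x y,
  [/\ is_germ c s x, s x = Some y, pinverse s t & is_germ d t y].

Lemma mk_germ s x : S s -> pdom s x -> exists c, is_germ c s x.
Proof.
move=> Ss sx; have cP : germ_class s x \in germ_classes.
  by apply/mem_set; exists s, x.
by exists (SigSub cP).
Qed.

Lemma unit_germ_ex x : exists c, is_unit_germ x c.
Proof.
have [s Ss sx] := pg_cover P x; have [t St st] := pg_inv Ss.
have idE y : pdom s y -> pcomp t s y = Some y.
  by rewrite /pdom /pcomp /=; case e: (s y) => [z|//] _ /=; apply/st.
have [|c cP] := @mk_germ (pcomp t s) x (pg_comp Ss St).
  by rewrite /pdom /= idE.
by exists c; exists (pcomp t s) => //; apply: filterS (near_pdom Ss sx) => y /idE.
Qed.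

Lemma inverse_germ_ex c : exists d, is_inverse_germ c d.
Proof.
have [s [x [Ss sx e]]] := is_germ_ex c; have [t St st] := pg_inv Ss.
case sE : (s x) => [y|]; last by [].
have [|d dP] := @mk_germ t y St; first by rewrite /pdom /= (st x y).1.
by exists d, s, t, x, y.
Qed.

Definition unit_germ x : germ := projT1 (cid (unit_germ_ex x)).

Definition inverse_germ c : germ := projT1 (cid (inverse_germ_ex c)).

End Germ.

Section Words.
Variable X : finType.
Implicit Types (u v w p : seq X) (phi : seq X -> seq X).

Definition tree_edge u v := exists x, v = rcons u x \/ u = rcons v x.

Definition tree_automorphism phi := [/\ bijective phi, phi [::] = [::] &
  forall u v, tree_edge u v <-> tree_edge (phi u) (phi v)].

(* the section [phi|_w], determined by [phi (w ++ v) = phi w ++ phi|_w v] *)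
Definition section phi w : seq X -> seq X := fun v => drop (size w) (phi (w ++ v)).

Definition finite_state phi := finite_set (range (section phi)).

Definition infword : topologicalType := {ptws nat -> discrete_topology X}.

Implicit Types (x y z : infword).

Definition infcat u x : infword :=
  fun n => if (n < size u)%N then nth (x n) u n else x (n - size u)%N.

Definition infdrop m x : infword := fun n => x (m + n)%N.

(* the action on infinite words: the prefix of length n+1 of the image of x is
   the image of the prefix [mkseq x n.+1]; the default [x n] is never used *)
Definition boundary phi x : infword := fun n => nth (x n) (phi (mkseq x n.+1)) n.

End Words.

Record self_similar_group (X : finType) := SelfSimilarGroup {
  ss_group :> groupType;
  ss_act : ss_group -> seq X -> seq X;
  ss_act1 : ss_act 1%g = id;
  ss_actM : forall g h, ss_act (g * h)%g = ss_act g \o ss_act h;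
  ss_aut : forall g, tree_automorphism (ss_act g);
  ss_faithful : injective ss_act;
  (* self-similarity: the sections of g belong to the group *)
  ss_section : forall g w, exists h, ss_act h = section (ss_act g) w
}.

Section TreeAutomorphism.
Variable X : finType.
Implicit Types (u v w p : seq X) (phi : seq X -> seq X) (x y z : infword X).

Lemma aut_rcons phi w : tree_automorphism phi ->
  size (phi w) = size w /\
  forall u a, w = rcons u a -> exists b, phi w = rcons (phi u) b.
Proof.
move=> [/bij_inj phi_inj phi0 phiE]; elim/last_ind: w => [|w a [IHs IH]].
  by rewrite phi0; split => // u a; case: u.
suff [b e] : exists b, phi (rcons w a) = rcons (phi w) b.
  rewrite e !size_rcons IHs; split => // u c /rcons_inj[<- _]; by exists b.
have : tree_edge w (rcons w a) by exists a; left.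
case/(phiE _ _).1 => b [e|e]; first by exists b.
have : (0 < size w)%N by rewrite -IHs e size_rcons.
case/lastP: w IHs IH e => // w c IHs IH e _.
have [b' e'] := IH _ _ erefl.
move: e; rewrite e' => /rcons_inj[/phi_inj/(congr1 size)].
by rewrite !size_rcons => /eqP; rewrite -addn2 -[X in X == _]addn0 eqn_add2l.
Qed.

Lemma aut_size phi w : tree_automorphism phi -> size (phi w) = size w.
Proof. by case/(aut_rcons w). Qed.

Lemma aut_cat phi w v : tree_automorphism phi ->
  phi (w ++ v) = phi w ++ section phi w v.
Proof.
move=> H; rewrite /section -{1}(cat_take_drop (size w) (phi (w ++ v))).
congr cat; elim/last_ind: v => [|v a IH].
  by rewrite cats0 -(aut_size w H) take_size.
rewrite -rcons_cat; have [b ->] := (aut_rcons (rcons (w ++ v) a) H).2 _ _ erefl.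
by rewrite -cats1 takel_cat // (aut_size _ H) size_cat leq_addr.
Qed.

Lemma infword_ext x y : (forall n, x n = y n) -> x = y.
Proof. by move=> e; apply/funext. Qed.

Lemma mkseq_infcat u x n : mkseq (infcat u x) (size u + n) = u ++ mkseq x n.
Proof.
apply: (@eq_from_nth _ (x 0)) => [|i]; rewrite size_mkseq ?size_cat ?size_mkseq //.
move=> lt_i; rewrite nth_mkseq // nth_cat /infcat; case: ltnP => [?|le_i].
  exact: (@set_nth_default X).
by rewrite nth_mkseq // -(ltn_add2l (size u)) subnKC.
Qed.

Lemma infcat_drop m x : infcat (mkseq x m) (infdrop m x) = x.
Proof.
apply: infword_ext => n; rewrite /infcat size_mkseq; case: ltnP => [?|?].
  by rewrite nth_mkseq.
by rewrite /infdrop subnKC.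
Qed.

Lemma infdrop_cat u x : infdrop (size u) (infcat u x) = x.
Proof. by apply: infword_ext => n; rewrite /infdrop /infcat ltnNge leq_addr addKn. Qed.

Lemma infcat_cat u v x : infcat (u ++ v) x = infcat u (infcat v x).
Proof.
apply: infword_ext => n; rewrite /infcat size_cat nth_cat.
have [h|h] := ltnP n (size u).
  by rewrite (leq_trans h) ?leq_addr //; exact: (@set_nth_default X).
rewrite -ltn_subLR // -subnDA; case: ifP => // h'.
exact: (@set_nth_default X).
Qed.

Lemma infcat_prefix u x : mkseq (infcat u x) (size u) = u.
Proof. by rewrite -[X in mkseq _ X]addn0 mkseq_infcat cats0. Qed.

Lemma infcat_inj u u' x x' : size u = size u' -> infcat u x = infcat u' x' ->
  u = u' /\ x = x'.
Proof.
move=> s e; have uu : u = u' by rewrite -(infcat_prefix u x) e s infcat_prefix.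
by split=> //; rewrite -(infdrop_cat u x) e -uu infdrop_cat.
Qed.

Lemma infcat_inj_le u u' x x' : (size u <= size u')%N ->
  infcat u x = infcat u' x' -> exists2 p, u' = u ++ p & x = infcat p x'.
Proof.
move=> h; rewrite -(cat_take_drop (size u) u') infcat_cat => /infcat_inj[|<- ->].
  by rewrite size_takel.
by exists (drop (size u) u').
Qed.

Lemma mkseq_boundary phi x n : tree_automorphism phi ->
  mkseq (boundary phi x) n = phi (mkseq x n).
Proof.
move=> H; elim: n => [|n IH]; first by have [_ ->] := H.
apply: (@eq_from_nth _ (x 0)) => [|i]; first by rewrite (aut_size _ H) !size_mkseq.
rewrite size_mkseq ltnS leq_eqVlt => /predU1P[->|lt_i].
  rewrite nth_mkseq // /boundary; apply: (@set_nth_default X).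
  by rewrite (aut_size _ H) size_mkseq.
rewrite [in RHS]/mkseq -addn1 iotaD map_cat (aut_cat _ _ H) nth_cat.
rewrite (aut_size _ H) -/(mkseq x n) size_mkseq lt_i -IH.
by rewrite !nth_mkseq // (leq_trans lt_i) // leq_addr.
Qed.

Lemma eq_mkseq_inf x y : (forall n, mkseq x n = mkseq y n) -> x = y.
Proof.
move=> e; apply: infword_ext => n.
by have := congr1 (nth (x 0) ^~ n) (e n.+1); rewrite !nth_mkseq.
Qed.

Lemma boundary_infcat phi psi w x : tree_automorphism phi ->
  tree_automorphism psi -> psi = section phi w ->
  boundary phi (infcat w x) = infcat (phi w) (boundary psi x).
Proof.
move=> H H' e; apply: eq_mkseq_inf => n; rewrite (mkseq_boundary _ _ H).
suff E m : mkseq (infcat (phi w) (boundary psi x)) (size w + m) =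
    phi (mkseq (infcat w x) (size w + m)).
  have K y : mkseq y n = take n (mkseq y (size w + n)).
    by rewrite /mkseq -map_take take_iota (minn_idPl (leq_addl _ _)).
  rewrite (K (infcat (phi w) _)) E (K (infcat w x)).
  set u := mkseq _ _; rewrite -{2}(cat_take_drop n u) (aut_cat _ _ H).
  have su : size (take n u) = n by rewrite size_takel // size_mkseq leq_addl.
  by rewrite take_cat (aut_size _ H) su ltnn subnn take0 cats0.
rewrite -{1}(aut_size w H) !mkseq_infcat (mkseq_boundary _ _ H').
by rewrite (aut_cat _ _ H) e.
Qed.

End TreeAutomorphism.

Section KPseudogroup.
Variables (X : finType) (G : self_similar_group X).
Implicit Types (u v w p : seq X) (x y z : infword X) (g h : G).

Local Notation act := (@ss_act X G).
Local Notation bd g := (boundary (act g)).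

(* the map [g_{u,v} : v w |-> u g(w)] *)
Definition gmap g u v : infword X -> option (infword X) :=
  fun x => if mkseq x (size v) == v
           then Some (infcat u (bd g (infdrop (size v) x))) else None.

(* The empty map makes this set closed under composition; it has no germs. *)
Definition Kmaps : set (infword X -> option (infword X)) :=
  [set s | (exists g u v, size u = size v /\ s = gmap g u v)
           \/ s = fun=> None].

Lemma bdM g h x : bd (g * h)%g x = bd g (bd h x).
Proof.
apply: eq_mkseq_inf => n.
rewrite (mkseq_boundary _ _ (ss_aut (g * h)%g)) (mkseq_boundary _ _ (ss_aut g)).
by rewrite (mkseq_boundary _ _ (ss_aut h)) ss_actM.
Qed.

Lemma bd1 x : bd 1%g x = x.
Proof.
apply: eq_mkseq_inf => n; rewrite (mkseq_boundary _ _ (ss_aut (1 : G)%g)).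
by rewrite ss_act1.
Qed.

Lemma bd_infcat g w : exists h, forall x, bd g (infcat w x) = infcat (act g w) (bd h x).
Proof.
have [h e] := ss_section g w; exists h => x.
by apply: boundary_infcat; [exact: ss_aut|exact: ss_aut|].
Qed.

Lemma act_size g w : size (act g w) = size w.
Proof. exact: aut_size (ss_aut g). Qed.

Lemma gmapP g u v x y : gmap g u v x = Some y <->
  exists2 w, x = infcat v w & y = infcat u (bd g w).
Proof.
rewrite /gmap; split=> [|[w -> ->]].
  case: eqP => // e [<-]; exists (infdrop (size v) x) => //.
  by rewrite -{1}e infcat_drop.
by rewrite infcat_prefix eqxx infdrop_cat.
Qed.

Lemma pmap_ext (s t : infword X -> option (infword X)) :
  (forall x y, s x = Some y <-> t x = Some y) -> s = t.
Proof.
move=> e; apply/funext => x; case E : (s x) => [y|].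
  by apply/esym/e.
by case E' : (t x) => [y|] //; move/e: E'; rewrite E.
Qed.

Lemma pcompP (s t : infword X -> option (infword X)) x y :
  pcomp t s x = Some y <-> exists2 z, s x = Some z & t z = Some y.
Proof.
rewrite /pcomp; case: (s x) => [z|] /=; last by split => // -[].
by split=> [|[z' [->]]] //; exists z.
Qed.

Lemma Kmaps_comp s t : Kmaps s -> Kmaps t -> Kmaps (pcomp t s).
Proof.
move=> [[h [u' [v' [s' ->]]]]|->]; last first.
  by move=> _; right.
move=> [[g [u [v [sz ->]]]]|->]; last first.
  by right; apply/funext => x; rewrite /pcomp; case: gmap.
case: (leqP (size v) (size u')) => [le|/ltnW le].
- have [e|ne] := eqVneq (take (size v) u') v; last first.
    right; apply: pmap_ext => x y; split => // /pcompP[z /gmapP[w _ ->]].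
    case/gmapP=> w2 /esym/(infcat_inj_le le)[p e _].
    by move: ne; rewrite e take_size_cat ?eqxx.
  move: e s'; rewrite -{2 3}(cat_take_drop (size v) u') => ->.
  move: (drop _ _) => p; rewrite size_cat => s'.
  have [k kP] := bd_infcat g p.
  left; exists (k * h)%g, (u ++ act g p), v'; split.
    by rewrite size_cat act_size sz.
  apply: pmap_ext => x y; split.
    case/pcompP=> z /gmapP[w -> ->] /gmapP[w2].
    rewrite infcat_cat => /infcat_inj[//|_ <-] ->.
    by apply/gmapP; exists w => //; rewrite kP infcat_cat bdM.
  case/gmapP=> w -> ->; apply/pcompP; exists (infcat (v ++ p) (bd h w)).
    by apply/gmapP; exists w.
  apply/gmapP; exists (infcat p (bd h w)); first by rewrite infcat_cat.
  by rewrite kP infcat_cat bdM.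
- have [e|ne] := eqVneq (take (size u') v) u'; last first.
    right; apply: pmap_ext => x y; split => // /pcompP[z /gmapP[w _ ->]].
    case/gmapP=> w2 /(infcat_inj_le le)[p e _].
    by move: ne; rewrite e take_size_cat ?eqxx.
  move: e sz; rewrite -{2 3}(cat_take_drop (size u') v) => ->.
  move: (drop _ _) => p; rewrite size_cat => sz.
  pose p' := act h^-1%g p.
  have hp' : act h p' = p.
    by rewrite /p' -[LHS]/((act h \o act h^-1%g) p) -ss_actM mulgV ss_act1.
  have [k kP] := bd_infcat h p'; have [k' k'P] := bd_infcat h^-1%g p.
  left; exists (g * k)%g, u, (v' ++ p'); split.
    by rewrite sz size_cat act_size s'.
  apply: pmap_ext => x y; split.
    case/pcompP=> z /gmapP[w -> ->] /gmapP[w2].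
    rewrite infcat_cat => /infcat_inj[//|_ e] ->.
    have we : w = infcat p' (bd k' w2) by rewrite -k'P -e -bdM mulVg bd1.
    apply/gmapP; exists (bd k' w2); first by rewrite infcat_cat -we.
    by rewrite bdM; move: e; rewrite we kP hp' => /infcat_inj[//|_ ->].
  case/gmapP=> w -> ->; rewrite infcat_cat bdM.
  apply/pcompP; exists (infcat u' (bd h (infcat p' w))).
    by apply/gmapP; exists (infcat p' w).
  by apply/gmapP; exists (bd k w) => //; rewrite kP hp' infcat_cat.
Qed.

Lemma Kmaps_inv s : Kmaps s -> exists2 t, Kmaps t & pinverse s t.
Proof.
case=> [[g [u [v [sz ->]]]]|->]; last by exists (fun=> None) => //; right.
exists (gmap g^-1%g v u); first by left; exists g^-1%g, v, u.
move=> x y; split=> /gmapP[w -> ->]; apply/gmapP.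
  by exists (bd g w) => //; rewrite -bdM mulVg bd1.
by exists (bd g^-1%g w) => //; rewrite -bdM mulgV bd1.
Qed.

Lemma gmap1 : gmap 1%g [::] [::] = Some.
Proof.
apply/funext => x; rewrite /gmap /= bd1; congr Some; apply: infword_ext => n.
by rewrite /infcat /infdrop /= subn0.
Qed.

Lemma Kmaps_cover x : exists2 s, Kmaps s & pdom s x.
Proof.
exists (gmap 1%g [::] [::]); first by left; exists 1%g, [::], [::].
by rewrite gmap1.
Qed.

Lemma nbhs_cylinder x m : nbhs x [set y | mkseq y m = mkseq x m].
Proof.
elim: m => [|m IH]; first exact: filterS filterT.
have xm : nbhs x [set y : infword X | y m = x m].
  exact: (@proj_continuous nat (fun=> discrete_topology X) m x
    [set a | a = x m] (@discrete_set1 (discrete_topology X) (x m))).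
apply: filterS2 IH xm => y /= e e'.
by rewrite !mkseqS e e'.
Qed.

Lemma infword_continuous (F : infword X -> infword X) :
  (forall n, exists m, forall x y, mkseq x m = mkseq y m -> F x n = F y n) ->
  continuous F.
Proof.
move=> H x U [] P [] [] Q QfinP <- [] V JV Vpz.
move/(@preimage_subset _ _ F)/filterS; apply.
apply: (@filterS _ _ _ (F @^-1` V)); first by exists V.
have [L Lsub /[dup] VL <-] := QfinP _ JV; rewrite preimage_bigcap.
apply: filter_bigI => /= M /[dup] LM /Lsub /set_mem [] w _ [+] + /[dup] + <-.
move=> N oN NM; have [m mP] := H w.
apply: filterS (nbhs_cylinder x m) => y /mP e /=.
move: Vpz; rewrite -VL => /(_ _ LM); rewrite -NM /=.
by rewrite e.
Qed.

Lemma Kmaps_continuous s : Kmaps s -> forall V, open V ->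
  open [set x | exists2 y, s x = Some y & V y].
Proof.
case=> [[g [u [v [_ ->]]]]|->] V oV; last first.
  by rewrite (_ : [set x | _] = set0); [exact: open0|apply/seteqP; split => // x []].
pose F x := infcat u (bd g (infdrop (size v) x)).
have cF : continuous F.
  apply: infword_continuous => n; exists (size v + n.+1)%N => x y e.
  have e' k : (k < size v + n.+1)%N -> x k = y k.
    by move=> kn; have := congr1 (nth (x 0) ^~ k) e; rewrite !nth_mkseq.
  rewrite /F /infcat; case: ifP => [h|_]; first exact: (@set_nth_default X).
  have e2 k : (k <= n)%N -> infdrop (size v) x k = infdrop (size v) y k.
    by move=> kn; apply: e'; rewrite ltn_add2l ltnS.
  rewrite /boundary; set m := (n - _)%N; have mn : (m <= n)%N := leq_subr _ _.
  rewrite e2 //; congr (nth _ (act g _) _); apply/eq_in_map => k.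
  by rewrite mem_iota /= add0n ltnS => km; rewrite e2 // (leq_trans km).
rewrite openE => x /= [y /gmapP[w xE yE] Vy].
have : nbhs x (F @^-1` V).
  apply: cF; apply: open_nbhs_nbhs; split => //.
  by rewrite /F xE infdrop_cat -yE.
apply: filterS2 (nbhs_cylinder x (size v)) => z /= e Fz; exists (F z) => //.
by rewrite /gmap e xE infcat_prefix eqxx.
Qed.

Definition Kpseudogroup : pseudogroup (infword X) :=
  Pseudogroup Kmaps_continuous Kmaps_comp Kmaps_inv Kmaps_cover.

End KPseudogroup.

Local Open Scope ring_scope.

(* the complex numbers over R, with the topology of a numFieldType *)
Definition Cx (R : realType) : numClosedFieldType := R[i]%C.

Record cstar_algebra (R : realType) := CstarAlgebra {
  cs_sort :> completeNormedModType (Cx R);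
  cs_mul : cs_sort -> cs_sort -> cs_sort;
  cs_star : cs_sort -> cs_sort;
  cs_mulA : associative cs_mul;
  cs_mulDl : left_distributive cs_mul +%R;
  cs_mulDr : right_distributive cs_mul +%R;
  cs_mulZl : forall c a b, cs_mul (c *: a) b = c *: cs_mul a b;
  cs_mulZr : forall c a b, cs_mul a (c *: b) = c *: cs_mul a b;
  cs_starK : involutive cs_star;
  cs_starD : {morph cs_star : a b / a + b};
  cs_starZ : forall c a, cs_star (c *: a) = c^* *: cs_star a;
  cs_starM : forall a b, cs_star (cs_mul a b) = cs_mul (cs_star b) (cs_star a);
  cs_normM : forall a b, `|cs_mul a b| <= `|a| * `|b|;
  cs_normC : forall a, `|cs_mul (cs_star a) a| = `|a| ^+ 2
}.

(* The norm of a normed module over Cx R takes its values in Cx R; this is the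
   same norm, as a real number. *)
Definition rnorm (R : realType) (V : normedModType (Cx R)) (a : V) : R :=
  complex.Re `|a|.

(* A linear functional tau such that tau (a^* a) >= 0 and of norm one. In Cx R,
   [0 <= z] means that z is real and nonnegative. The [sup] of an unbounded set
   of reals is 0 by convention, so the last clause implies boundedness. *)
Definition is_state (R : realType) (A : cstar_algebra R) (tau : A -> Cx R) :=
  [/\ forall c a b, tau (c *: a + b) = c * tau a + tau b,
      forall a, 0 <= tau (cs_mul (cs_star a) a) &
      sup [set complex.Re `|tau a| | a in [set a : A | rnorm a <= 1]] = 1].

Definition is_tracial_state (R : realType) (A : cstar_algebra R)
    (tau : A -> Cx R) :=
  is_state tau /\ forall a b, tau (cs_mul a b) = tau (cs_mul b a).

Definition nowhere_dense (T : topologicalType) (A : set T) := (closure A)^° = set0.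

Definition meagre (T : topologicalType) (A : set T) :=
  exists2 F : nat -> set T, forall n, nowhere_dense (F n) & A `<=` \bigcup_n F n.

(* The data of a topological groupoid which enter the definition of its
   convolution algebra: [gp_prod g1 g2 g] means that (g1, g2) is composable with
   g1 g2 = g, and [gp_unit] identifies [gp_base] with the space of units. *)
Record groupoid_data := GroupoidData {
  gp_arrow : topologicalType;
  gp_base : topologicalType;
  gp_unit : gp_base -> gp_arrow;
  gp_prod : gp_arrow -> gp_arrow -> gp_arrow -> Prop;
  gp_inv : gp_arrow -> gp_arrow
}.

Definition germ_groupoid (Y : topologicalType) (P : pseudogroup Y) :=
  {| gp_arrow := germ P; gp_base := Y; gp_unit := @unit_germ Y P;
     gp_prod := @germ_prod Y P; gp_inv := @inverse_germ Y P |}.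

Definition Kgroupoid (X : finType) (G : self_similar_group X) :=
  germ_groupoid (Kpseudogroup G).

Section GroupoidAlgebra.
Variables (R : realType) (G : groupoid_data).

Local Notation C := (Cx R).
Local Notation arrow := (gp_arrow G).
Local Notation base := (gp_base G).

Implicit Types a b f : arrow -> C.

Definition is_continuous_compact_support (U : set arrow) f :=
  [/\ {within U, continuous f},
      compact (U `&` closure [set g | f g <> 0]) &
      forall g, ~ U g -> f g = 0].

Definition Cc : set (arrow -> C) := [set f |
  exists (n : nat) (c : 'I_n -> C) (h : 'I_n -> arrow -> C),
    (forall i, exists U : set arrow, [/\ open U, hausdorff_space (set_type U) &
       is_continuous_compact_support U (h i)]) /\
    f = fun g => \sum_(i < n) c i * h i g].

(* a finite sum for a and b in [Cc]: only finitely many of its terms are nonzero *)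
Definition convolution a b : arrow -> C := fun g =>
  \sum_(p \in [set p : arrow * arrow | gp_prod p.1 p.2 g]) a p.1 * b p.2.

Definition Cc_star a : arrow -> C := fun g => (a (gp_inv g))^*.

Definition is_cstar_seminorm (p : (arrow -> C) -> R) :=
  [/\ forall a, Cc a -> 0 <= p a,
      forall c a, Cc a -> p (c *: a) = complex.Re `|c| * p a,
      forall a b, Cc a -> Cc b -> p (a + b) <= p a + p b,
      forall a b, Cc a -> Cc b -> p (convolution a b) <= p a * p b &
      forall a, Cc a -> p (convolution (Cc_star a) a) = p a ^+ 2].

(* A, together with iota, is the completion of [Cc] in the supremum of all
   C*-seminorms; only the values of iota on [Cc] are meaningful. *)
Definition is_full_cstar (A : cstar_algebra R) (iota : (arrow -> C) -> A) :=
  [/\ forall c a b, Cc a -> Cc b -> iota (c *: a + b) = c *: iota a + iota b,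
      forall a b, Cc a -> Cc b -> iota (convolution a b) = cs_mul (iota a) (iota b),
      forall a, Cc a -> iota (Cc_star a) = cs_star (iota a),
      forall a, Cc a -> (rnorm (iota a))%:E =
        ereal_sup [set (p a)%:E | p in is_cstar_seminorm] &
      dense (iota @` Cc)].

Definition Borel_fun (f : base -> C) :=
  forall V : set C, open V -> <<s open >> (f @^-1` V).

Definition is_expectation (A : cstar_algebra R) (iota : (arrow -> C) -> A)
    (E : A -> base -> C) :=
  [/\ forall a : A, Borel_fun (E a),
      forall c (a b : A), E (c *: a + b) = c *: E a + E b,
      forall (a : A) x, complex.Re `|E a x| <= rnorm a,
      forall (a : A) x, 0 <= E (cs_mul (cs_star a) a) x &
      forall a, Cc a -> forall x, E (iota a) x = a (gp_unit x)].

Definition singular_ideal (A : cstar_algebra R) (E : A -> base -> C) : set A :=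
  [set a : A | meagre [set x | E (cs_mul (cs_star a) a) x <> 0]].

(* B, together with q, is the quotient of A by the closed ideal J. *)
Definition is_quotient (A : cstar_algebra R) (J : set A)
    (B : cstar_algebra R) (q : A -> B) :=
  [/\ forall c (a b : A), q (c *: a + b) = c *: q a + q b,
      forall (a b : A), q (cs_mul a b) = cs_mul (q a) (q b),
      forall a : A, q (cs_star a) = cs_star (q a),
      (forall b : B, exists a : A, q a = b) /\ (forall a : A, q a = 0 <-> J a) &
      forall a : A, rnorm (q a) = inf [set rnorm (a + j) | j in J]].

(* C*(G), E and C*_ess(G) are determined up to unique isomorphism by the
   conditions below; the predicate says that B is a copy of C*_ess(G). *)
Definition is_essential_cstar (B : cstar_algebra R) :=
  exists (A : cstar_algebra R) (iota : (arrow -> C) -> A) (E : A -> base -> C)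
         (q : A -> B),
    [/\ is_full_cstar iota, is_expectation iota E &
        is_quotient (singular_ideal E) q].

End GroupoidAlgebra.

(* Main.v *)
From mathcomp Require Import all_boot all_order all_algebra.
From mathcomp Require Import all_classical all_reals all_analysis.
From mathcomp Require Import complex ring zify.
Require Import Defs.

(* The uniform Bernoulli measure mu on X^N gives every cylinder of level n the
   mass |X|^-n. For a tracial functional sigma on C*(K) and the partial isometry
   1_s attached to a partial map s, cut 1_s along the words w of length n. If s
   is the identity on the cylinder of w, the piece has trace sigma(1) |X|^-n; if
   s maps no point of this cylinder into it, the piece has trace 0; in the
   remaining bad cases Cauchy-Schwarz bounds the trace by 2 sigma(1) |X|^-n. For
   a finite-state automorphism the proportion of bad words tends to 0, since
   each nontrivial section moves some word of a fixed length. Hence sigma is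
   determined on the 1_s, which span a dense subspace, by sigma(1).
   Conversely, for the same reason the Riemann sums of E(a) over the cylinders
   of level n converge for every a, whatever the sample points, and their limit
   tau(a) (the integral of E(a) against mu) is a trace. If a lies in the singular
   ideal, the Baire property provides sample points at which E(a^* a) vanishes,
   so that tau(a^* a) = 0 and tau descends to the essential C*-algebra. *)

Set Implicit Arguments.
Unset Strict Implicit.
Unset Printing Implicit Defensive.

Import Order.TTheory GRing.Theory Num.Theory.
Import numFieldNormedType.Exports.

Local Open Scope classical_set_scope.
Local Open Scope ring_scope.

(** * Germs and functions supported on a bisection *)

(** The groupoid need not be Hausdorff: the set where a map is locally the identity is open but may
    fail to be closed, so [E] takes values in Borel functions instead of continuous ones. A meagre
    set may have positive mass for mu, so an integral of [E a] against mu has no reason to vanish on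
    the singular ideal; this is why the convergence of the Riemann sums is proved uniformly over all
    choices of sample points. The full C*-algebra is known only through the supremum of its
    C*-seminorms, so norm estimates come from the seminorm axioms; a sup bound for functions on one
    bisection is enough. Uniqueness is settled on the full algebra: every contractive positive trace
    there is a multiple of tau, so a trace on the quotient need only be pulled back. *)

Section GermTheory.
Variables (Y : topologicalType) (P : pseudogroup Y).
Local Notation S := (pg_maps P).
Implicit Types (s t a b : Y -> option Y) (x y z : Y) (c d : germ P).

Lemma is_germ_source c s x : is_germ c s x -> germ_source c = x.
Proof. by case=> _ _; rewrite /germ_source => ->. Qed.

Lemma is_germ_near c s t x y : is_germ c s x -> is_germ c t y ->
  x = y /\ \forall z \near x, s z <> None /\ t z = s z.
Proof.
move=> gs gt; have xy : x = y by rewrite -(is_germ_source gs) (is_germ_source gt).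
split=> //; subst y; case: gs gt => Ss sx es [St tx et].
by apply: (@germ_class_eq _ P) => //; rewrite -es.
Qed.

Lemma is_germ_agree c s t x : is_germ c s x -> S t ->
  (\forall z \near x, s z <> None /\ t z = s z) -> is_germ c t x.
Proof.
move=> [Ss sx es] St st; have [sx' tx] := nbhs_singleton st.
by split=> //; [rewrite /pdom /= tx|rewrite es; apply: germ_classE].
Qed.

Lemma is_germ_inj c d s x : is_germ c s x -> is_germ d s x -> c = d.
Proof. by move=> [_ _ ec] [_ _ ed]; apply/val_inj; rewrite [LHS]ec [RHS]ed. Qed.

Lemma near_image s x y (V : set Y) : S s -> s x = Some y -> nbhs y V ->
  \forall z \near x, exists2 w, s z = Some w & V w.
Proof.
move=> Ss sx; rewrite nbhsE => -[W [oW Wy] WV].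
have := pg_continuous Ss oW; rewrite openE => /(_ x) H.
have : nbhs x [set z | exists2 w, s z = Some w & W w] by apply: H; exists y.
by apply: filterS => z [w sz Ww]; exists w => //; exact: WV.
Qed.

Lemma near_comp s s' t t' x y : S s -> s x = Some y ->
  (\forall z \near x, s z <> None /\ s' z = s z) ->
  (\forall z \near y, t z <> None /\ t' z = t z) ->
  \forall z \near x, pcomp t s z <> None /\ pcomp t' s' z = pcomp t s z.
Proof.
move=> Ss sx ss tt; have := near_image Ss sx tt.
apply: filterS2 ss => z [sz s'z] [w sw [tw t'w]].
by rewrite /pcomp s'z sw.
Qed.

Lemma germ_prod_comp c2 c1 c s t x y : is_germ c1 s x -> s x = Some y ->
  is_germ c2 t y -> germ_prod c2 c1 c -> is_germ c (pcomp t s) x.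
Proof.
move=> g1 sx g2 [t' [s' [x' [y' [g1' sx' g2' g]]]]].
have [xx ss] := is_germ_near g1' g1; subst x'.
have yy : y' = y.
  by have [_ e] := nbhs_singleton ss; move: e; rewrite sx sx' => -[].
subst y'; have [_ tt] := is_germ_near g2' g2.
apply: (is_germ_agree g); first by apply: pg_comp; [case: g1|case: g2].
by apply: near_comp sx' ss tt; case: g1'.
Qed.

Lemma open_theta s (V : set Y) : S s -> open V -> V `<=` pdom s ->
  open (@theta Y P (s, V)).
Proof.
move=> Ss oV Vs; exists [set (s, V)]; last by rewrite bigcup_set1.
by move=> _ ->; split.
Qed.

Definition bisection s : set (germ P) := [set c | exists x, is_germ c s x].

Lemma bisectionE s : S s -> bisection s = @theta Y P (s, pdom s).
Proof.
move=> Ss; apply/seteqP; split => [c [x g]|c [x sx g]]; last by exists x.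
by exists x => //; case: g.
Qed.

Lemma open_bisection s : S s -> open (bisection s).
Proof. by move=> Ss; rewrite bisectionE //; apply: open_theta => //; exact: (open_pdom Ss). Qed.

(** The source map carries [bisection s] homeomorphically onto [pdom s]. Testing neighbourhoods on
    the base, through one representative, replaces the basis [theta] in the later topological
    arguments. *)
Lemma nbhs_germ c s x (A : set (germ P)) : is_germ c s x -> nbhs c A <->
  \forall y \near x, s y <> None /\ forall d, is_germ d s y -> A d.
Proof.
move=> g; split.
  rewrite nbhsE => -[_ [[D Di <-] [[t V] Dt [x' /= Vx g']]] sub].
  have [_ oV /= Vt] := Di _ Dt.
  have [xx ts] := is_germ_near g' g; subst x'.
  have nV : nbhs x V by apply: open_nbhs_nbhs.
  have nts := ts; move: ts => /nbhs_interior ts.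
  apply: filterS2 nV ts => y Vy /= tsy.
  have [ty sty] := nbhs_singleton tsy.
  split=> [|d gd]; first by rewrite sty.
  apply: sub; exists (t, V) => //; exists y => //=.
  apply: (is_germ_agree gd); first by case: g'.
  by apply: filterS tsy => z [tz ->]; split.
move=> H; have [W [oW Wx] WA] : exists2 W, open_nbhs x W &
    forall y, W y -> s y <> None /\ forall d, is_germ d s y -> A d.
  by move: H; rewrite /prop_near1 nbhsE => -[W ? ?]; exists W.
have [Ss sx _] := g.
have oT : open (@theta Y P (s, W)).
  by apply: open_theta => // y /WA [].
apply: (@filterS _ _ _ (@theta Y P (s, W))); last first.
  by apply: open_nbhs_nbhs; split => //; exists x.
by move=> d [y /= Wy gd]; have [_] := WA _ Wy; exact.
Qed.

Lemma source_continuous : continuous (@germ_source Y P).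
Proof.
move=> c V; have [s [x g]] := is_germ_ex c; rewrite (is_germ_source g) => nV.
apply/(nbhs_germ _ g); have [Ss sx _] := g.
apply: filterS2 nV (near_pdom Ss sx) => y Vy sy; split=> // d gd.
by rewrite /preimage /= (is_germ_source gd).
Qed.

Lemma is_inverse_germ_bisection c d s s' : S s -> S s' -> pinverse s s' ->
  is_inverse_germ c d -> bisection s d ->
  bisection s' c /\ s' (germ_source c) = Some (germ_source d).
Proof.
move=> Ss Ss' ss' [a [b [x [y [gc ax ab gd]]]]] [y' gd'].
have [yy bs] := is_germ_near gd gd'; subst y'.
rewrite (is_germ_source gc) (is_germ_source gd).
have Sa : S a by case: gc.
have H : \forall z \near x, a z <> None /\ s' z = a z.
  have := near_image Sa ax bs; apply: filterS => z [w az [_ e]].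
  split; first by rewrite az.
  by rewrite az; apply/ss'; rewrite e; apply/ab.
split; last by have [_ ->] := nbhs_singleton H.
by exists x; apply: is_germ_agree gc _ H.
Qed.

Lemma pinverse_sym s t : pinverse s t -> pinverse t s.
Proof. by move=> st x y; split=> /st. Qed.

Lemma is_inverse_germ_sym c d : is_inverse_germ c d -> is_inverse_germ d c.
Proof.
move=> [a [b [x [y [gc ax ab gd]]]]]; exists b, a, y, x; split=> //.
  exact/ab.
exact: pinverse_sym.
Qed.

Lemma inverse_germP c : is_inverse_germ c (inverse_germ c).
Proof. exact: (projT2 (cid (inverse_germ_ex c))). Qed.

(** It is not enough that [s] fixes x: the condition describes the interior of the fixed-point set
    of [s]. Its indicator function will be the expectation of 1_s. *)
Lemma unit_germ_bisection x s : S s ->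
  bisection s (unit_germ P x) <-> \forall y \near x, s y = Some y.
Proof.
move=> Ss; have [t gt tx] : is_unit_germ x (unit_germ P x).
  exact: (projT2 (cid (unit_germ_ex P x))).
split=> [[x' gs]|sx].
  have [_ ts] := is_germ_near gt gs.
  by apply: filterS2 tx ts => y -> [_].
exists x; apply: is_germ_agree gt Ss _.
by apply: filterS2 tx sx => y -> ->.
Qed.

Lemma unit_germ_source x : germ_source (unit_germ P x) = x.
Proof.
have [t gt tx] : is_unit_germ x (unit_germ P x).
  exact: (projT2 (cid (unit_germ_ex P x))).
exact: is_germ_source gt.
Qed.

Variable R : realType.
Local Notation C := (Cx R).
Implicit Types f h : Y -> C.

Definition germ_lift s f : germ P -> C := fun c =>
  if `[< bisection s c >] then f (germ_source c) else 0.

Lemma germ_lift_in s f c : bisection s c -> germ_lift s f c = f (germ_source c).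
Proof. by move=> sc; rewrite /germ_lift asboolT. Qed.

Lemma germ_lift_out s f c : ~ bisection s c -> germ_lift s f c = 0.
Proof. by move=> sc; rewrite /germ_lift asboolF. Qed.

(** An arrow factors in at most one way through the bisections of s and t: its source determines the
    factor in t, and this one determines the factor in s. So the convolution sum has at most one
    nonzero term. *)
Lemma convolution_germ_lift s t f h : S s -> S t ->
  @convolution R (germ_groupoid P) (germ_lift s f) (germ_lift t h) =
  germ_lift (pcomp s t) (fun x => oapp f 0 (t x) * h x).
Proof.
move=> Ss St; apply/funext => c; rewrite /convolution /=.
have key (p : germ P * germ P) : germ_prod p.1 p.2 c ->
    germ_lift s f p.1 * germ_lift t h p.2 <> 0 ->
    exists x y, [/\ is_germ p.2 t x, t x = Some y, is_germ p.1 s y &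
                  is_germ c (pcomp s t) x].
  move=> pc; have [[y gy] nz|nb] := pselect (bisection s p.1); last first.
    by rewrite germ_lift_out // mul0r.
  have [[x gx]|nb] := pselect (bisection t p.2); last first.
    by move: nz; rewrite [X in _ * X]germ_lift_out // mulr0.
  exists x, y; suff tx : t x = Some y.
    by split=> //; exact: germ_prod_comp gx tx gy pc.
  have [t' [s' [x' [y' [g1 tx' g2 _]]]]] := pc.
  have [xx /nbhs_singleton[_ e]] := is_germ_near g1 gx; subst x'.
  have [yy _] := is_germ_near g2 gy; subst y'.
  by rewrite e tx'.
have [[x gc]|nc] := pselect (bisection (pcomp s t) c); last first.
  rewrite germ_lift_out //; apply: fsbig1 => p pc.
  apply: contrapT => /(key _ pc)[x [y [_ _ _ g]]].
  by apply: nc; exists x.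
have [Sst stx _] := gc.
have [y ty sy] : exists2 y, t x = Some y & pdom s y.
  by move: stx; rewrite /pdom /pcomp /=; case: (t x) => //= y; exists y.
have [|c1 g1] := @mk_germ _ P t x St; first by rewrite /pdom /= ty.
have [c2 g2] := @mk_germ _ P s y Ss sy.
rewrite germ_lift_in; last by exists x.
rewrite (is_germ_source gc) ty /=.
rewrite -[RHS](_ : \sum_(p \in [set (c2, c1)]) germ_lift s f p.1 * germ_lift t h p.2 = _).
  apply/esym/fsbig_widen => [_ -> /=|p [/= pc ne]]; first by exists s, t, x, y.
  apply: contrapT => /(key _ pc)[x' [y' [g1' ty' g2' g]]]; apply: ne.
  have xx : x' = x by rewrite -(is_germ_source g) (is_germ_source gc).
  subst x'; move: ty'; rewrite ty => -[yy]; subst y'.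
  by rewrite [p]surjective_pairing (is_germ_inj g1' g1) (is_germ_inj g2' g2).
rewrite fsbig_set1 /= !germ_lift_in; [|by exists x|by exists y].
by rewrite (is_germ_source g1) (is_germ_source g2).
Qed.

Lemma Cc_star_germ_lift s s' f : S s -> S s' -> pinverse s s' ->
  @Cc_star R (germ_groupoid P) (germ_lift s f) =
  germ_lift s' (fun x => (oapp f 0 (s' x))^*).
Proof.
move=> Ss Ss' ss'; apply/funext => c; rewrite /Cc_star /=.
have inv := inverse_germP c.
have [sc|sc] := pselect (bisection s (inverse_germ c)).
  have [s'c e] := is_inverse_germ_bisection Ss Ss' ss' inv sc.
  by rewrite !germ_lift_in // e.
rewrite !germ_lift_out ?conjC0 // => s'c; apply: sc.
have [] := is_inverse_germ_bisection Ss' Ss (pinverse_sym ss')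
  (is_inverse_germ_sym inv) s'c.
by [].
Qed.

Lemma germ_lift_unit s f x : S s -> germ_lift s f (unit_germ P x) =
  if `[< \forall y \near x, s y = Some y >] then f x else 0.
Proof.
by move=> Ss; rewrite /germ_lift unit_germ_source (asbool_equiv_eq (unit_germ_bisection x Ss)).
Qed.

Lemma eq_germ_lift s s' f f' : (forall c x, is_germ c s x -> bisection s' c /\ f x = f' x) ->
  (forall c x, is_germ c s' x -> f' x <> 0 -> bisection s c) ->
  germ_lift s f = germ_lift s' f'.
Proof.
move=> H H'; apply/funext => c.
have [[x g]|nc] := pselect (bisection s c).
  have [s'c e] := H _ _ g.
  by rewrite !germ_lift_in //; [rewrite (is_germ_source g)|exists x].
rewrite germ_lift_out //.
have [[x g]|nc'] := pselect (bisection s' c); last by rewrite germ_lift_out.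
rewrite germ_lift_in; last by exists x.
by rewrite (is_germ_source g); apply: contrapT => /nesym/(H' _ _ g).
Qed.

Hypothesis hausY : hausdorff_space Y.

Lemma hausdorff_bisection s : hausdorff_space (set_type (bisection s)).
Proof.
move=> p q pq.
have inj : germ_source (set_val p) = germ_source (set_val q) -> p = q.
  have [x gp] := set_valP p; have [y gq] := set_valP q.
  rewrite (is_germ_source gp) (is_germ_source gq) => e; subst y.
  by apply/val_inj; exact: is_germ_inj gp gq.
apply: inj; apply: hausY => A B nA nB.
have cont : continuous (fun r : set_type (bisection s) => germ_source (set_val r)).
  move=> r; apply: continuous_comp; first exact: initial_continuous.
  exact: source_continuous.
have [r [Ar Br]] := pq _ _ (cont p A nA) (cont q B nB).
by exists (germ_source (set_val r)).
Qed.

Lemma compact_bisection s : S s -> compact (pdom s) -> compact (bisection s).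
Proof.
move=> Ss cs.
have [->|/set0P[c0 _]] := eqVneq (bisection s) set0; first exact: compact0.
pose g x : germ P :=
  if pselect (pdom s x) is left sx then projT1 (cid (mk_germ Ss sx)) else c0.
have gE x : pdom s x -> is_germ (g x) s x.
  by rewrite /g; case: pselect => // sx _; exact: (projT2 (cid (mk_germ Ss sx))).
have -> : bisection s = g @` pdom s.
  apply/seteqP; split=> [c [x gc]|_ [x sx <-]]; last by exists x; exact: gE.
  exists x; first by case: gc.
  by apply: (is_germ_inj (gE x _) gc); case: gc.
apply: continuous_compact => //.
have /continuous_open_subspace -> := open_pdom Ss.
move=> x /set_mem sx A /(nbhs_germ _ (gE x sx)).
by apply: filterS => y [sy]; apply; exact: gE.
Qed.

End GermTheory.

(** * The C*-seminorms of such functions *)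

Section ComplexNumbers.
Variable R : realType.
Local Notation C := (Cx R).
Implicit Types (r : R) (z w : C).

Definition toC r : C := real_complex R r.

Lemma toCM r r' : toC (r * r') = toC r * toC r'.
Proof. exact: rmorphM. Qed.

Lemma toCD r r' : toC (r + r') = toC r + toC r'.
Proof. exact: rmorphD. Qed.

Lemma toCN r : toC (- r) = - toC r.
Proof. exact: rmorphN. Qed.

Lemma toC0 : toC 0 = 0. Proof. exact: (rmorph0 (real_complex R)). Qed.
Lemma toC1 : toC 1 = 1. Proof. exact: (rmorph1 (real_complex R)). Qed.

Lemma toC_nat n : toC n%:R = n%:R. Proof. exact: rmorph_nat. Qed.

Lemma toCX r n : toC (r ^+ n) = toC r ^+ n. Proof. exact: rmorphXn. Qed.

Lemma toCV r : toC r^-1 = (toC r)^-1. Proof. exact: fmorphV. Qed.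

Lemma ler_toC r r' : (toC r <= toC r') = (r <= r').
Proof. exact: lecR. Qed.

Lemma ltr_toC r r' : (toC r < toC r') = (r < r').
Proof. exact: ltcR. Qed.

Lemma toC_ge0 r : (0 <= toC r) = (0 <= r).
Proof. by rewrite -toC0 ler_toC. Qed.

Lemma toC_gt0 r : (0 < toC r) = (0 < r).
Proof. by rewrite -toC0 ltr_toC. Qed.

Lemma Re_toC r : complex.Re (toC r) = r. Proof. by []. Qed.

Lemma toC_real r : toC r \is Num.real.
Proof. by rewrite realE toC_ge0 -oppr_ge0 -toCN toC_ge0 oppr_ge0 -realE num_real. Qed.

Lemma conj_toC r : (toC r)^* = toC r.
Proof. by apply/CrealP/toC_real. Qed.

Lemma Re_real z : z \is Num.real -> toC (complex.Re z) = z.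
Proof. exact: RRe_real. Qed.

Lemma Re_ge0 z : 0 <= z -> toC (complex.Re z) = z.
Proof. by move=> z0; rewrite Re_real // realE z0. Qed.

Lemma Re_norm z : toC (complex.Re `|z|) = `|z|.
Proof. exact: Re_ge0. Qed.

Lemma norm_toC r : `|toC r| = toC `|r|.
Proof.
have [r0|r0] := lerP 0 r; first by rewrite !ger0_norm ?toC_ge0.
by rewrite [in RHS]ltr0_norm // toCN ltr0_norm // -toC0 ltr_toC.
Qed.

Lemma ReD z w : complex.Re (z + w) = complex.Re z + complex.Re w.
Proof. by case: z w => [a b] [c d]. Qed.

Lemma ReN z : complex.Re (- z) = - complex.Re z.
Proof. by case: z => [a b]. Qed.

Lemma norm_Re_le z : `|complex.Re z| <= complex.Re `|z|.
Proof.
case: z => a b; rewrite /= -sqrtr_sqr; apply: ler_wsqrtr.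
by rewrite lerDl sqr_ge0.
Qed.

Lemma toC_eps (e : C) : 0 < e -> exists2 r, 0 < r & e = toC r.
Proof.
move=> e0; exists (complex.Re e); last by rewrite Re_ge0 // ltW.
by rewrite -toC_gt0 Re_ge0 // ltW.
Qed.

Lemma cvg_toC (T : topologicalType) (h : T -> R) x : {for x, continuous h} ->
  toC (h y) @[y --> x] --> toC (h x).
Proof.
move=> ch; apply/cvgrPdist_lt => e /toC_eps[r r0 ->] /=.
have /cvgrPdist_lt/(_ _ r0) := ch; apply: filterS => y hy.
by rewrite -toCN -toCD norm_toC ltr_toC.
Qed.

Lemma cvg_Re (T : topologicalType) (f : T -> C) x : {for x, continuous f} ->
  {for x, continuous (fun y => complex.Re (f y))}.
Proof.
move=> cf; apply/cvgrPdist_lt => e e0 /=.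
have e0' : 0 < toC e by rewrite toC_gt0.
have /cvgrPdist_lt/(_ _ e0') := cf; apply: filterS => y fy.
rewrite -ReN -ReD; apply: le_lt_trans (norm_Re_le _) _.
by rewrite -ltr_toC Re_norm.
Qed.

End ComplexNumbers.

Section GermAlgebra.
Variables (Y : topologicalType) (P : pseudogroup Y) (R : realType).
Local Notation S := (pg_maps P).
Local Notation C := (Cx R).
Local Notation K := (germ_groupoid P).
Local Notation lift := (@germ_lift Y P R).
Implicit Types (s t : Y -> option Y) (x y : Y) (f : Y -> C).

Hypotheses (hausY : hausdorff_space Y) (compY : compact [set: Y]).
Hypothesis closed_dom : forall s, S s -> closed (pdom s).
Hypothesis idS : S Some.

Lemma germ_lift_continuous s f c : (forall x, pdom s x -> {for x, continuous f}) ->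
  bisection s c -> {for c, continuous (lift s f)}.
Proof.
move=> cf sc V; rewrite /= germ_lift_in // => nV.
have [x g] := sc; have [Ss sx _] := g.
suff : nbhs c (lift s f @^-1` V) by [].
apply/(nbhs_germ _ g); move: nV; rewrite (is_germ_source g) => nV.
have fV : \forall y \near x, V (f y) := cf _ sx _ nV.
apply: filterS2 fV (near_pdom Ss sx) => y Vy sy; split=> // d gd.
rewrite /preimage /= germ_lift_in ?(is_germ_source gd) //; by exists y.
Qed.

(** The domain of [s] is closed in a compact space, so the whole bisection is compact and continuity
    on it already gives compact support. *)
Lemma Cc_continuous_bisection s (h : germ P -> C) : S s ->
  (forall c, bisection s c -> {for c, continuous h}) ->
  (forall c, ~ bisection s c -> h c = 0) -> @Cc R K h.
Proof.
move=> Ss ch h0; exists 1%N, (fun=> 1), (fun=> h); split; last first.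
  by apply/funext => c; rewrite big_ord1 mul1r.
move=> _; exists (bisection s); split.
- exact: open_bisection.
- exact: hausdorff_bisection.
split=> //.
- have /continuous_open_subspace -> := open_bisection Ss.
  by move=> c /set_mem; exact: ch.
- apply: compact_closedI; last exact: closed_closure.
  apply: compact_bisection => //.
  by rewrite -[pdom s]setTI; apply: compact_closedI => //; exact: closed_dom.
Qed.

Lemma Cc_germ_lift s f : S s -> (forall x, pdom s x -> {for x, continuous f}) ->
  @Cc R K (lift s f).
Proof.
move=> Ss cf; apply: (Cc_continuous_bisection Ss).
  by move=> c; exact: germ_lift_continuous.
by move=> c; exact: germ_lift_out.
Qed.

Lemma germ_lift_linear s (k : C) f f' :
  lift s (fun x => k * f x + f' x) = k *: lift s f + lift s f'.
Proof.
apply/funext => c; rewrite -[RHS]/(k * lift s f c + lift s f' c) /germ_lift.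
by case: ifP => // _; rewrite mulr0 addr0.
Qed.

Lemma convolution_unit_lift f f' :
  @convolution R K (lift Some f) (lift Some f') = lift Some (fun x => f x * f' x).
Proof. by rewrite convolution_germ_lift. Qed.

Lemma Cc_star_unit_lift f :
  @Cc_star R K (lift Some f) = lift Some (fun x => (f x)^*).
Proof. by rewrite (@Cc_star_germ_lift _ _ _ Some Some) //; split=> -[->]. Qed.

(** The product lives on the unit space, where it is |f|^2 cut down to the domain of [s]. Through
    the C*-identity, seminorms of lifts are controlled by functions on the unit space. *)
Lemma star_germ_lift s f : S s ->
  @convolution R K (@Cc_star R K (lift s f)) (lift s f) =
  lift Some (fun x => if s x is Some _ then (f x)^* * f x else 0).
Proof.
move=> Ss; have [s' Ss' ss'] := pg_inv Ss.
rewrite (Cc_star_germ_lift _ Ss Ss' ss') convolution_germ_lift //.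
have sK x y : s x = Some y -> s' y = Some x by move/ss'.
apply: eq_germ_lift => c x g.
  have [_ dx _] := g; move: dx; rewrite /pdom /pcomp /=.
  case sx: (s x) => [y|] //= _; rewrite (sK _ _ sx) /=; split=> //.
  exists x; apply: is_germ_agree g idS _.
  apply: filterS (near_pdom Ss (_ : pdom s x)); last by rewrite /pdom /= sx.
  by move=> z; rewrite /pcomp; case sz : (s z) => [w|] //= _; rewrite (sK _ _ sz).
case sx: (s x) => [y|] // _; exists x.
apply: is_germ_agree g (pg_comp Ss Ss') _.
apply: filterS (near_pdom Ss (_ : pdom s x)); last by rewrite /pdom /= sx.
by move=> z; rewrite /pcomp; case sz : (s z) => [w|] //= _; rewrite (sK _ _ sz).
Qed.

Section Seminorm.
Variable p : (germ P -> C) -> R.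
Hypothesis sp : @is_cstar_seminorm R K p.

(** The unit is a self-adjoint idempotent, so the C*-identity makes its seminorm q a solution of q =
    q^2. *)
Lemma seminorm_unit : p (lift Some (fun=> 1)) <= 1.
Proof.
have [p0 _ _ _ pC] := sp.
have c1 : Cc (lift Some (fun=> 1) : gp_arrow K -> C).
  by apply: Cc_germ_lift => // x _; exact: cvg_cst.
have := pC _ c1; rewrite Cc_star_unit_lift convolution_unit_lift.
under eq_fun do rewrite conjC1 mul1r.
have := p0 _ c1; set q := p _ => q0 qq; rewrite leNgt; apply/negP => q1.
by have := ltr_pM2l (lt_trans ltr01 q1) 1 q; rewrite mulr1 -expr2 -qq ltxx q1.
Qed.

(* A real function of modulus at most one is the mean of two unitaries. *)
Lemma seminorm_real_unit (h : Y -> R) : continuous h -> (forall x, `|h x| <= 1) ->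
  p (lift Some (@toC R \o h)) <= 1.
Proof.
move=> ch h1; have [p0 pZ pD _ pC] := sp.
pose k x := Num.sqrt (1 - h x ^+ 2).
have hk x : h x ^+ 2 + k x ^+ 2 = 1.
  rewrite sqr_sqrtr; first by rewrite addrC subrK.
  by rewrite subr_ge0 -real_normK ?num_real // expr_le1.
have ck : continuous k.
  move=> x; apply: (@continuous_comp _ _ _ (fun y => 1 - h y ^+ 2) Num.sqrt).
    apply: cvgB; first exact: cvg_cst.
    apply: (continuous_comp (f := h) (g := fun r => r ^+ 2)); first exact: ch.
    exact: exprn_continuous.
  exact: sqrt_continuous.
(* The unitaries are h + e i k with e = 1 and e = -1. By the C*-identity the square of their
   seminorm is that of the unit, hence at most 1. *)
pose u (e : C) x : C := e * ('i * toC (k x)) + toC (h x).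
have cu e x : {for x, continuous (u e)}.
  apply: cvgD; last by apply: cvg_toC; exact: ch.
  by do 2 (apply: cvgM; first exact: cvg_cst); apply: cvg_toC; exact: ck.
have pu e : e \is Num.real -> e ^+ 2 = 1 -> p (lift Some (u e)) <= 1.
  move=> er e2; have Cu : @Cc R K (lift Some (u e)) by apply: Cc_germ_lift.
  have := pC _ Cu; rewrite Cc_star_unit_lift convolution_unit_lift.
  rewrite (_ : (fun x => _) = fun=> 1); last first.
    apply/funext => x; rewrite /u rmorphD !rmorphM /= conjCi !conj_toC.
    have -> : e^* = e by apply/CrealP.
    rewrite (_ : _ * _ = toC (h x) ^+ 2 - ('i ^+ 2 * e ^+ 2) * toC (k x) ^+ 2); last by ring.
    by rewrite sqrCi e2 mulr1 mulN1r opprK -!toCX -toCD hk toC1.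
  have := p0 _ Cu; set q := p (lift _ _) => q0 qq.
  have := seminorm_unit; rewrite qq; rewrite expr_le1 //.
have two : (2%:R : C) != 0 by rewrite pnatr_eq0.
have -> : lift Some (@toC R \o h) =
    2^-1 *: lift Some (u 1) + 2^-1 *: lift Some (u (-1)).
  rewrite -[in RHS](addr0 (2^-1 *: lift _ (u (-1)))).
  have -> : 0 = lift Some (fun=> 0).
    by apply/funext => c; rewrite /germ_lift if_same.
  rewrite -!germ_lift_linear; congr germ_lift; apply/funext => x /=.
  by rewrite /u; field.
have C1 : @Cc R K (lift Some (u 1)) by apply: Cc_germ_lift.
have C2 : @Cc R K (lift Some (u (-1))) by apply: Cc_germ_lift.
have CZ f e : (forall x, {for x, continuous f}) -> @Cc R K (e *: lift Some f).
  move=> cf; have -> : e *: lift Some f = lift Some (fun x => e * f x).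
    by apply/funext => c; rewrite -[LHS]/(e * _) /germ_lift; case: ifP => // _; rewrite mulr0.
  apply: Cc_germ_lift; first exact: idS.
  by move=> x _; exact: (cvgM (cvg_cst e) (cf x)).
apply: le_trans (pD _ _ (CZ _ _ (cu 1)) (CZ _ _ (cu (-1)))) _.
rewrite !pZ // -mulrDr.
have -> : complex.Re `|2^-1 : C| = 2^-1.
  by rewrite -[in LHS](toC_nat R 2) -toCV norm_toC Re_toC ger0_norm // invr_ge0.
rewrite mulrC ler_pdivrMr // mul1r -[leRHS]/(1 + 1).
by apply: lerD; apply: pu; rewrite ?realN ?real1 // ?sqrrN expr1n.
Qed.

(** The C*-identity turns the claim into a bound for |f|^2 / M^2, a real function of modulus at most
    one on the unit space. Extended by 0 it stays continuous, as the domain of [s] is open and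
    closed. *)
Lemma seminorm_germ_lift s f (M : R) : S s -> 0 < M ->
  (forall x, pdom s x -> {for x, continuous f}) ->
  (forall x, pdom s x -> `|f x| <= toC M) -> p (lift s f) <= M.
Proof.
move=> Ss M0 cf fM; have [p0 pZ pD _ pC] := sp.
have Cf : @Cc R K (lift s f) by exact: Cc_germ_lift.
pose h x : R := if s x is Some _ then complex.Re `|f x| ^+ 2 / M ^+ 2 else 0.
have hE x : toC (M ^+ 2) * toC (h x) = if s x is Some _ then (f x)^* * f x else 0.
  rewrite /h; case: (s x) => [y|]; last by rewrite toC0 mulr0.
  rewrite -toCM mulrC divfK ?expf_neq0 ?gt_eqF //.
  by rewrite toCX Re_norm normCK mulrC.
have h1 x : `|h x| <= 1.
  rewrite /h; case sx : (s x) => [y|]; last by rewrite normr0.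
  rewrite ger0_norm ?divr_ge0 ?sqr_ge0 // ler_pdivrMr ?exprn_gt0 // mul1r.
  rewrite lerXn2r ?nnegrE ?(ltW M0) //; first by rewrite -toC_ge0 Re_norm.
  by rewrite -ler_toC Re_norm; apply: fM; rewrite /pdom /= sx.
have ch : continuous h.
  move=> x; have [sx|sx] := pselect (pdom s x); last first.
    have nx : \forall y \near x, (~` pdom s) y.
      by apply: open_nbhs_nbhs; split => //; rewrite openC; exact: closed_dom.
    apply: cvg_trans (_ : cst 0 @ x --> h x).
      apply: near_eq_cvg; apply: filterS nx => y; rewrite /pdom /h /=.
      by case: (s y) => // z []. 
    have -> : h x = 0 by move: sx; rewrite /h /pdom /=; case: (s x) => // y [].
    exact: cvg_cst.
  have cn : {for x, continuous (fun y => complex.Re `|f y| ^+ 2 / M ^+ 2)}.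
    apply: cvgM; last exact: cvg_cst.
    apply: (@continuous_comp _ _ _ (fun y => complex.Re `|f y|) (fun r => r ^+ 2)).
      apply: cvg_Re; apply: (@continuous_comp _ _ _ f (fun z : C => `|z|)).
        exact: cf.
      exact: norm_continuous.
    exact: exprn_continuous.
  rewrite /continuous_at; have -> : h x = complex.Re `|f x| ^+ 2 / M ^+ 2.
    by move: sx; rewrite /h /pdom /=; case: (s x).
  apply: cvg_trans cn; apply: near_eq_cvg; apply: filterS (near_pdom Ss sx) => y.
  by rewrite /h; case: (s y).
have := pC _ Cf; rewrite star_germ_lift //.
rewrite (_ : lift Some _ = toC (M ^+ 2) *: lift Some (@toC R \o h)); last first.
  apply/funext => c; rewrite -[RHS]/(toC (M ^+ 2) * _) /germ_lift.
  by case: ifP => // _; rewrite ?mulr0 // hE.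
rewrite pZ; last by apply: Cc_germ_lift; [exact: idS|move=> x _; apply: cvg_toC; exact: ch].
rewrite norm_toC Re_toC ger0_norm ?sqr_ge0 // => e.
have := seminorm_real_unit ch h1; rewrite -(ler_pM2l (_ : 0 < M ^+ 2)) ?exprn_gt0 //.
by rewrite e mulr1 ler_pXn2r ?nnegrE ?(ltW M0) //; exact: (p0 _ Cf).
Qed.

End Seminorm.
End GermAlgebra.

(** * Infinite words *)

Section WordTopology.
Variable X : finType.
Implicit Types (u v w : seq X) (x y z : infword X).

Definition cylinder w : set (infword X) := [set x | mkseq x (size w) = w].

Lemma mkseq_take x m n : (m <= n)%N -> take m (mkseq x n) = mkseq x m.
Proof. by move=> mn; rewrite /mkseq -map_take take_iota (minn_idPl mn). Qed.

Lemma mkseq_le x y m n : (m <= n)%N -> mkseq x n = mkseq y n ->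
  mkseq x m = mkseq y m.
Proof. by move=> mn e; rewrite -!(mkseq_take _ mn) e. Qed.

Lemma cylinder_mkseq x n : cylinder (mkseq x n) x.
Proof. by rewrite /cylinder /= size_mkseq. Qed.

Lemma cylinder_cat u v : cylinder (u ++ v) `<=` cylinder u.
Proof.
move=> x; rewrite /cylinder /= => e.
by rewrite -(mkseq_take x (leq_addr (size v) (size u))) -size_cat e take_size_cat.
Qed.

Lemma nbhs_infwordP x (A : set (infword X)) :
  nbhs x A <-> exists m, forall y, mkseq y m = mkseq x m -> A y.
Proof.
split=> [nA|[m H]]; last first.
  by apply: filterS (nbhs_cylinder x m) => y /H.
(* [F] is the filter generated by the cylinders at x. The product topology is a supremum of initial
   topologies, so convergence of [F] to x can be checked in each coordinate. *)
pose F : set_system (infword X) := [set B | exists m, forall y, mkseq y m = mkseq x m -> B y].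
have FF : Filter F.
  split; first by exists 0%N.
    move=> B B' [m Bm] [n Bn]; exists (maxn m n) => y e; split.
      by apply: Bm; apply: mkseq_le e; rewrite leq_maxl.
    by apply: Bn; apply: mkseq_le e; rewrite leq_maxr.
  by move=> B B' BB' [m Bm]; exists m => y /Bm /BB'.
suff Fx : cvg_to F (nbhs x) by exact: Fx nA.
apply/cvg_sup => i U [V] [[W] oW <-] Wx WU.
exists i.+1 => y e; apply: WU => /=.
suff -> : y i = x i by [].
by have := congr1 (nth (x 0%N) ^~ i) e; rewrite !nth_mkseq.
Qed.

Lemma open_cylinder w : open (cylinder w).
Proof.
rewrite openE => x xw; apply/nbhs_infwordP; exists (size w) => y.
by rewrite /cylinder /= => ->.
Qed.

Lemma infword_hausdorff : hausdorff_space (infword X).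
Proof.
move=> x y xy; apply: eq_mkseq_inf => n.
have [z [xz yz]] := xy _ _ (nbhs_cylinder x n) (nbhs_cylinder y n).
by rewrite -xz.
Qed.

Lemma infword_compact : compact [set: infword X].
Proof.
rewrite (_ : [set: _] = [set f : forall i : nat, discrete_topology X |
    forall i, [set: discrete_topology X] (f i)]).
  apply: (@tychonoff nat (fun=> discrete_topology X) (fun=> setT)) => _.
  apply: finite_compact.
  by have := @finite_finset X setT.
by apply/seteqP; split.
Qed.

Fixpoint words n : seq (seq X) :=
  if n is n'.+1 then [seq a :: w | a <- enum X, w <- words n'] else [:: [::]].

Lemma mem_words n w : (w \in words n) = (size w == n).
Proof.
elim: n w => [|n IH] [|x w] //=.
- by apply/allpairsP => -[[? ?] []].
- apply/allpairsP/idP => [[[y v] /= [_ + [_ ->]]]|sw].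
    by rewrite IH eqSS.
  by exists (x, w); split=> //=; rewrite ?mem_enum // IH.
Qed.

Lemma uniq_words n : uniq (words n).
Proof.
elim: n => //= n IH; apply: allpairs_uniq => //; first exact: enum_uniq.
by move=> [x u] [y v] _ _ [-> ->].
Qed.

Lemma size_words n : size (words n) = (#|X| ^ n)%N.
Proof. by elim: n => //= n IH; rewrite size_allpairs IH -cardE expnS. Qed.

Lemma perm_words n m :
  perm_eq (words (n + m)) [seq u ++ v | u <- words n, v <- words m].
Proof.
apply: uniq_perm; first exact: uniq_words.
  apply: allpairs_uniq; try exact: uniq_words.
  move=> [u v] [u' v'] /allpairsP[[a b] /= [ha _ [-> ->]]].
  move=> /allpairsP[[a' b'] /= [ha' _ [-> ->]]] /=.
  move: ha ha'; rewrite !mem_words => /eqP ha /eqP ha' /eqP.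
  by rewrite eqseq_cat ?ha ?ha' // => /andP[/eqP -> /eqP ->].
move=> w; rewrite mem_words; apply/eqP/allpairsP => [sw|[[u v] /= [+ + ->]]].
  exists (take n w, drop n w); rewrite /= !mem_words cat_take_drop; split=> //.
    by rewrite size_takel // sw leq_addr.
  by rewrite size_drop sw addKn.
by rewrite !mem_words size_cat => /eqP -> /eqP ->.
Qed.

(** Compactness of X^N, used as a near covering with n tending to infinity, makes the level uniform.
    Uniform continuity will be derived from it. *)
Lemma fan_theorem (Q : seq X -> Prop) : (forall u v, Q u -> Q (u ++ v)) ->
  (forall x, exists n, Q (mkseq x n)) -> exists N, forall w, (N <= size w)%N -> Q w.
Proof.
move=> Qcat Qx; case: (pickP (@predT X)) => [a _|nX].
  (* Over an empty alphabet there is no word of positive length. *)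
  2: by exists 1%N => -[|a w] //; have := nX a.
pose x0 : infword X := fun=> a.
have /compact_near_coveringP := infword_compact.
move=> /(_ _ \oo (fun n x => Q (mkseq x n)) _).
case=> [x _|N _ NQ].
  have [n Qn] := Qx x.
  exists ([set y | mkseq y n = mkseq x n], [set m | (n <= m)%N]) => /=.
    by split; [exact: nbhs_cylinder|exists n].
  move=> [y m] /= [e nm].
  have -> : mkseq y m = mkseq x n ++ drop n (mkseq y m).
    by rewrite -e -(mkseq_take y nm) cat_take_drop.
  exact: Qcat.
exists N => w sw; have := NQ _ sw (infcat w x0) I.
by rewrite /= infcat_prefix.
Qed.

End WordTopology.

(** * Bad words of the partial maps g_{u,v} *)

Lemma sum_words (X : finType) (V : nmodType) n m (F : seq X -> V) :
  \sum_(w <- words X (n + m)) F w =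
  \sum_(u <- words X n) \sum_(v <- words X m) F (u ++ v).
Proof. by rewrite (perm_big _ (perm_words X n m)) big_allpairs_dep. Qed.

Lemma count_words_sum (X : finType) (V : nzSemiRingType) (Q : pred (seq X)) n :
  (count Q (words X n))%:R = \sum_(w <- words X n) (Q w)%:R :> V.
Proof.
by rewrite -sum1_count big_mkcond natr_sum; apply: eq_bigr => w _; case: (Q w).
Qed.

(** * Decay of the proportion of stuck words *)

Section FiniteStateDensity.
Variables (X : finType) (a0 : X) (phi : seq X -> seq X).
Hypothesis sec_aut : forall w, tree_automorphism (section phi w).
Hypothesis fin : finite_state phi.
Implicit Types (psi : seq X -> seq X) (u v w : seq X).

(** At such a word the fixed points are still undecided: [psi] fixes the word but not all of its
    extensions. *)
Definition stuck psi w := (psi w == w) && `[< section psi w <> id >].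

Lemma section_cat psi u v : section (section psi u) v = section psi (u ++ v).
Proof. by apply/funext => w; rewrite /section drop_drop size_cat catA addnC. Qed.

Lemma section_id u : section id u = id.
Proof. by apply/funext => v; rewrite /section drop_size_cat. Qed.

Lemma stuck_cat psi u v : tree_automorphism psi -> stuck psi (u ++ v) ->
  stuck psi u && stuck (section psi u) v.
Proof.
move=> aut; rewrite /stuck (aut_cat _ _ aut) eqseq_cat ?(aut_size _ aut) //.
rewrite -section_cat => /andP[/andP[-> ->]] /asboolP ne /=.
rewrite andbC; apply/andP; split; apply/asboolP => // e.
by apply: ne; rewrite e section_id.
Qed.

(** Finite-stateness enters here: choose a moved word for each nontrivial section and take the
    maximal length over the finitely many sections. *)
Lemma moved_level : exists m, forall w, section phi w <> id ->
  exists2 v, size v = m & section phi w v <> v.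
Proof.
have H psi : exists v, psi <> id -> psi v <> v.
  have [/existsNP[v ?]|] := pselect (~ forall v, psi v = v); first by exists v.
  by move=> /contrapT e; exists [::] => ne; exfalso; apply: ne; apply/funext.
have [f fP] := choice H.
have /finite_seqP[s sE] := fin.
exists (\max_(psi <- s) size (f psi)) => w ne; set m := \max_(_ <- _) _.
have wm : (size (f (section phi w)) <= m)%N.
  have ws : section phi w \in s.
    have : range (section phi) (section phi w) by exists w.
    by rewrite sE.
  exact: (leq_bigmax_seq (F := fun psi => size (f psi))).
(* Padding with [a0] to the common length keeps the word moved, as automorphisms respect
   prefixes. *)
exists (f (section phi w) ++ nseq (m - size (f (section phi w))) a0).
  by rewrite size_cat size_nseq subnKC.
rewrite (aut_cat _ _ (sec_aut w)) => /eqP.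
rewrite eqseq_cat ?(aut_size _ (sec_aut w)) // => /andP[/eqP e _].
exact: fP e.
Qed.

Lemma count_stuck_cat psi k l : tree_automorphism psi ->
  (count (stuck psi) (words X (k + l)) <=
   \sum_(u <- words X k | stuck psi u) count (stuck (section psi u)) (words X l))%N.
Proof.
move=> aut; rewrite -sum1_count big_mkcond /= sum_words [leqRHS]big_mkcond /=.
apply: leq_sum => u _; rewrite -sum1_count [X in if _ then X else _]big_mkcond /=.
case: ifP => su.
  apply: leq_sum => v _; case: ifP => // /(stuck_cat aut).
  by rewrite su => /= ->.
rewrite big1 // => v _; case: ifP => // /(stuck_cat aut).
by rewrite su.
Qed.

(** Below every stuck word at least one of the |X|^m extensions by m letters is moved, hence not
    stuck; this loss recurs in each of the j blocks. *)
Lemma count_stuck_pow m : (forall w, section phi w <> id ->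
    exists2 v, size v = m & section phi w v <> v) ->
  forall j w, (count (stuck (section phi w)) (words X (j * m)) <=
    (#|X| ^ m - 1) ^ j)%N.
Proof.
move=> mP.
have base w : (count (stuck (section phi w)) (words X m) <= #|X| ^ m - 1)%N.
  have [e|/mP[v sv ne]] := pselect (section phi w = id).
    rewrite e (@eq_count _ _ pred0) ?count_pred0 // => u.
    rewrite /stuck section_id; apply/negbTE/nandP; right.
    exact/asboolPn.
  rewrite -(size_words X m) leq_subRL; last first.
    by rewrite size_words expn_gt0; apply/orP; left; apply/card_gt0P; exists a0.
  rewrite -(count_predC (stuck (section phi w))) addnC leq_add2l -has_count.
  apply/hasP; exists v; first by rewrite mem_words sv.
  by apply/nandP; left; apply/eqP.
elim=> [|j IH] w; first by rewrite mul0n /= addn0 expn0; case: (stuck _ _).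
rewrite mulSn; apply: leq_trans (count_stuck_cat _ _ (sec_aut w)) _.
apply: leq_trans (_ : \sum_(u <- words X m | stuck (section phi w) u)
  (#|X| ^ m - 1) ^ j <= _)%N.
  by apply: leq_sum => u _; rewrite section_cat.
by rewrite big_const_seq iter_addn_0 mulnC expnS leq_mul2r base orbT.
Qed.

Lemma count_stuck_small (R : realType) (e : R) : 0 < e -> exists N, forall n,
  (N <= n)%N -> (count (stuck phi) (words X n))%:R <= e * (#|X| ^ n)%:R.
Proof.
move=> e0; have [m mP] := moved_level.
have phiE : section phi [::] = phi by apply/funext => v; rewrite /section drop0.
have Xm : (0 < #|X| ^ m)%N.
  by rewrite expn_gt0; apply/orP; left; apply/card_gt0P; exists a0.
pose r : R := (#|X| ^ m - 1)%:R / (#|X| ^ m)%:R.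
have r0 : 0 <= r by rewrite divr_ge0.
have r1 : `|r| < 1.
  rewrite ger0_norm // ltr_pdivrMr ?ltr0n // mul1r ltr_nat.
  by rewrite -subn_gt0 subKn.
have /cvgrPdist_lt/(_ _ e0)[j _ jP] := cvg_expr r1.
(* Split off j blocks of m letters, with r^j < e; the remaining l letters are counted without any
   saving. *)
exists (j * m)%N => n jn; rewrite -(subnKC jn); set l := (n - _)%N.
have := jP j (leqnn _); rewrite /= sub0r normrN ger0_norm ?exprn_ge0 // => rj.
have H : (count (stuck phi) (words X (j * m + l)) <=
    (#|X| ^ m - 1) ^ j * #|X| ^ l)%N.
  rewrite -phiE; apply: leq_trans (count_stuck_cat _ _ (sec_aut _)) _.
  apply: leq_trans (_ : \sum_(u <- words X (j * m) | stuck (section phi [::]) u)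
    #|X| ^ l <= _)%N.
    by apply: leq_sum => u _; rewrite -(size_words X l) count_size.
  by rewrite big_const_seq iter_addn_0 mulnC leq_mul2r (count_stuck_pow mP) orbT.
apply: (@le_trans _ _ (r ^+ j * (#|X| ^ (j * m + l))%:R)); last first.
  by rewrite ler_wpM2r // ltW.
rewrite (_ : r ^+ j * _ = ((#|X| ^ m - 1) ^ j * #|X| ^ l)%:R) ?ler_nat //.
rewrite /r expr_div_n expnD (mulnC j) expnM !natrM !(natrX _ _ j).
by rewrite mulrA divfK // expf_neq0 // pnatr_eq0 -lt0n.
Qed.

End FiniteStateDensity.

(** * Fixed, returning and bad cylinders of the maps g_{u,v} *)

Section KMaps.
Variables (X : finType) (a0 : X) (G : self_similar_group X).
Implicit Types (s t : infword X -> option (infword X)) (u v w : seq X) (x y z : infword X).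
Local Notation S := (pg_maps (Kpseudogroup G)).

Lemma Kmaps_id : S Some.
Proof. by left; exists 1%g, [::], [::]; rewrite gmap1. Qed.

Definition word_swap u v : infword X -> option (infword X) :=
  fun x => if mkseq x (size v) == v then Some (infcat u (infdrop (size v) x)) else None.

Lemma Kmaps_swap u v : size u = size v -> S (word_swap u v).
Proof.
move=> uv; left; exists 1%g, u, v; split=> //.
by apply/funext => x; rewrite /gmap bd1.
Qed.

Definition word_id w : infword X -> option (infword X) :=
  fun x => if mkseq x (size w) == w then Some x else None.

Lemma word_swap_id w : word_swap w w = word_id w.
Proof.
apply/funext => x; rewrite /word_swap /word_id; case: eqP => // e.
by rewrite -[in LHS]e size_mkseq infcat_drop.
Qed.

Lemma Kmaps_word_id w : S (word_id w).
Proof. by rewrite -word_swap_id; exact: Kmaps_swap. Qed.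

(** From level N on, [s] acts on words of length n and is defined everywhere or nowhere on a
    cylinder. For g_{u,v} one may take N = |v|. *)
Definition level s N := forall n, (N <= n)%N -> forall x x' y, s x = Some y ->
  mkseq x' n = mkseq x n -> exists2 y', s x' = Some y' & mkseq y' n = mkseq y n.

Lemma Kmaps_level s : S s -> exists N, level s N.
Proof.
case=> [[g [u [v [uv ->]]]]|->]; last by exists 0%N.
exists (size v) => n vn x x' y /gmapP[w -> ->]; rewrite -(subnKC vn) mkseq_infcat.
set k := (n - _)%N => e.
have e1 : mkseq x' (size v) = v.
  by rewrite -(mkseq_take x' (leq_addr k _)) e take_size_cat.
move: e; rewrite -(infcat_drop (size v) x') e1 mkseq_infcat => /eqP.
rewrite eqseq_cat // eqxx => /= /eqP e.
exists (infcat u (boundary (ss_act g) (infdrop (size v) x'))); first by apply/gmapP; eexists.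
have -> : (size v + k = size u + k)%N by rewrite uv.
by rewrite !mkseq_infcat !(mkseq_boundary _ _ (ss_aut g)) e.
Qed.

Lemma closed_pdom_level s N : level s N -> closed (pdom s).
Proof.
move=> sN; rewrite -openC openE => x nx; apply/nbhs_infwordP; exists N => y e sy.
apply: nx; rewrite /pdom /=; move: sy; rewrite /pdom /=.
case sE : (s y) => [z|] // _.
by have [z' -> _] := sN _ (leqnn _) _ _ _ sE (esym e).
Qed.

Definition fixing s w := `[< forall x, cylinder w x -> s x = Some x >].

Definition returning s w := `[< exists x y, [/\ cylinder w x, s x = Some y & cylinder w y] >].

(* At a bad word w a trace of 1_s 1_w is not determined by the level |w|. *)
Definition bad s w := ~~ fixing s w && returning s w.

Lemma fixing_cat s u v : fixing s u -> fixing s (u ++ v).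
Proof. by move=> /asboolP H; apply/asboolP => x /cylinder_cat; exact: H. Qed.

(** If u and v differ, g_{u,v} moves every cylinder of level at least |v| off itself. If they agree,
    a long bad word is v followed by a stuck word of g, and the decay of stuck words applies. *)
Lemma bad_small (R : realType) s (e : R) : (forall g : G, finite_state (ss_act g)) ->
  S s -> 0 < e -> exists N, forall n,
  (N <= n)%N -> (count (bad s) (words X n))%:R <= e * (#|X| ^ n)%:R.
Proof.
move=> fin Ss e0.
have trivial N : (forall w, (N <= size w)%N -> ~~ bad s w) -> exists N, forall n,
  (N <= n)%N -> (count (bad s) (words X n))%:R <= e * (#|X| ^ n)%:R.
  move=> H; exists N => n Nn; rewrite (_ : count _ _ = 0%N); last first.
    apply/eqP; rewrite -leqn0 leqNgt -has_count; apply/hasPn => w.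
    by rewrite mem_words => /eqP ws; apply: H; rewrite ws.
  by rewrite mulr_ge0 // ltW.
case: Ss => [[g [u [v [uv sE]]]]|sE]; last first.
  apply: (trivial 0%N) => w _; apply/nandP; right; apply/asboolPn.
  by rewrite sE => -[x [y []]].
have [vu|ne] := eqVneq v u; last first.
  apply: (trivial (size v)) => w vw; apply/nandP; right; apply/asboolPn.
  move=> [x [y [wx + wy]]]; rewrite sE => /gmapP[z xE yE].
  move/eqP: ne; apply.
  have := congr1 (take (size v)) (etrans wx (esym wy)).
  by rewrite !mkseq_take // xE yE infcat_prefix -uv infcat_prefix.
subst u; clear uv.
have aut w : tree_automorphism (section (ss_act g) w).
  by have [h <-] := ss_section g w; exact: ss_aut.
have [N NP] := count_stuck_small a0 aut (fin g) e0.
exists (size v + N)%N => n; move=> vNn.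
have vn : (size v <= n)%N by apply: leq_trans vNn; rewrite leq_addr.
apply: (@le_trans _ _ (count (stuck (ss_act g)) (words X (n - size v)))%:R).
  rewrite ler_nat -!size_filter.
  rewrite -[leqRHS](size_map (cat v)); apply: uniq_leq_size.
    by rewrite filter_uniq // uniq_words.
  move=> w; rewrite mem_filter mem_words => /andP[/andP[nf rw] /eqP wn].
  move/asboolP: rw => [x [y [wx sx wy]]].
  move: sx; rewrite sE => /gmapP[z xE yE].
  have wv : take (size v) w = v.
    by rewrite -wx wn mkseq_take // xE infcat_prefix.
  apply/mapP; exists (drop (size v) w); last by rewrite -{1}wv cat_take_drop.
  rewrite mem_filter mem_words size_drop wn eqxx andbT.
  move: nf wx wy wn; rewrite -{1 2 3}(cat_take_drop (size v) w) wv; move: (drop _ _) => w'.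
  rewrite /cylinder /= size_cat xE yE !mkseq_infcat => nf.
  move=> /eqP; rewrite eqseq_cat // eqxx /= => /eqP w'z.
  move=> /eqP; rewrite eqseq_cat // eqxx /= => /eqP.
  rewrite (mkseq_boundary _ _ (ss_aut g)) w'z => w'g _.
  apply/andP; split; first exact/eqP.
  apply/asboolP => sid; move/asboolP: nf; apply => x' wx'.
  have -> : x' = infcat (v ++ w') (infdrop (size (v ++ w')) x').
    by rewrite -{1}wx' infcat_drop.
  rewrite sE; apply/gmapP; exists (infcat w' (infdrop (size (v ++ w')) x')).
    by rewrite infcat_cat.
  have [h hE] := ss_section g w'.
  rewrite (boundary_infcat _ (ss_aut g) (ss_aut h) hE) w'g infcat_cat; congr infcat; congr infcat.
  apply: eq_mkseq_inf => k; rewrite (mkseq_boundary _ _ (ss_aut h)).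
  by rewrite hE sid.
apply: le_trans (NP _ _) _; first by rewrite leq_subRL.
rewrite ler_wpM2l ?(ltW e0) // ler_nat leq_pexp2l ?leq_subr //.
by apply/card_gt0P; exists a0.
Qed.

(* t maps the cylinders fixed by s t injectively to cylinders fixed by t s. *)
Lemma count_fixing_comp s t : S s -> S t -> exists N, forall n, (N <= n)%N ->
  (count (fixing (pcomp s t)) (words X n) <= count (fixing (pcomp t s)) (words X n))%N.
Proof.
move=> Ss St; have [t' St' tt'] := pg_inv St.
(* The level is that of the inverse of t, because a whole cylinder around an image point is pulled
   back into the cylinder of w. *)
have [N tN] := Kmaps_level St'; exists N => n Nn.
pose x0 w : infword X := infcat w (fun=> a0).
(* The image cylinder is read off at one sample point; the default [[::]] does not occur for words
   fixed by s t. *)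
pose f w : seq X := if t (x0 w) is Some y then mkseq y n else [::].
have key w : fixing (pcomp s t) w -> size w = n ->
    exists y, [/\ t (x0 w) = Some y, f w = mkseq y n & forall z, mkseq z n = mkseq y n ->
     exists x, [/\ t x = Some z, mkseq x n = w & pcomp t s z = Some z]].
  move=> /asboolP fw wn.
  have := fw (x0 w); rewrite /cylinder /= infcat_prefix => /(_ erefl)/pcompP[y ty sy].
  exists y; split=> //; first by rewrite /f ty.
  move=> z zy; have [x t'z xw] := tN _ Nn _ _ _ ((tt' _ _).1 ty) zy.
  have tx : t x = Some z by apply/tt'.
  have xw' : mkseq x n = w by rewrite xw /x0 -wn infcat_prefix.
  exists x; split=> //.
  have := fw x; rewrite /cylinder /= wn => /(_ xw')/pcompP[z' tz' sz'].
  move: tz'; rewrite tx => -[zz]; subst z'.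
  by apply/pcompP; exists x.
rewrite -!size_filter -[leqLHS](size_map f); apply: uniq_leq_size.
  rewrite map_inj_in_uniq ?filter_uniq ?uniq_words // => w w'.
  rewrite !mem_filter !mem_words => /andP[fw /eqP wn] /andP[fw' /eqP wn'].
  have [y [ty -> Hy]] := key _ fw wn.
  have [y' [ty' -> Hy']] := key _ fw' wn' => e.
  have [x [tx xw _]] := Hy _ (esym e).
  have xx : x = x0 w'.
    by apply/(@Some_inj); rewrite -((tt' _ _).1 tx) -((tt' _ _).1 ty').
  by rewrite -xw xx /x0 -wn' infcat_prefix.
move=> _ /mapP[w + ->]; rewrite !mem_filter !mem_words => /andP[fw /eqP wn].
have [y [ty -> Hy]] := key _ fw wn; rewrite size_mkseq eqxx andbT.
apply/asboolP => z; rewrite /cylinder /= size_mkseq => /Hy[x [_ _ ->]].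
by [].
Qed.

End KMaps.

(** * Density of the span of the partial isometries *)

Lemma near_continuous (T U : topologicalType) (f g : T -> U) x :
  (\forall y \near x, g y = f y) -> {for x, continuous g} -> {for x, continuous f}.
Proof.
move=> fg cg V; rewrite /= -(nbhs_singleton fg) => nV.
have gV : \forall y \near x, V (g y) := cg V nV.
suff : \forall y \near x, V (f y) by [].
by apply: filterS2 fg gV => y ->.
Qed.

Lemma axpy_continuous (R : realType) (T : topologicalType) (k : Cx R)
  (f g : T -> Cx R) x : {for x, continuous f} -> {for x, continuous g} ->
  {for x, continuous (fun y => k * f y + g y)}.
Proof. by move=> cf cg; exact: (cvgD (cvgM (cvg_cst k) cf) cg). Qed.

Lemma locally_cst_continuous (T U : topologicalType) (f : T -> U) x :
  (\forall y \near x, f y = f x) -> {for x, continuous f}.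
Proof.
move=> fx V nV; suff : \forall y \near x, V (f y) by [].
by apply: filterS fx => y ->; exact: nbhs_singleton.
Qed.

Section FullAlgebra.
Variables (X : finType) (a0 : X) (G : self_similar_group X) (R : realType).
Local Notation Y := (infword X).
Local Notation P := (Kpseudogroup G).
Local Notation S := (pg_maps P).
Local Notation C := (Cx R).
Local Notation lift := (@germ_lift Y P R).
Local Notation K := (Kgroupoid G).
Implicit Types (s t : Y -> option Y) (u v w : seq X) (x y z : Y) (f : Y -> C).

Variables (A : cstar_algebra R) (iota : (gp_arrow K -> C) -> A).
Hypothesis full : is_full_cstar iota.

Lemma rnormE (V : normedModType C) (a : V) : toC (rnorm a) = `|a|.
Proof. exact: Re_ge0. Qed.

Lemma Kmaps_closed_dom s : S s -> closed (pdom s).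
Proof. by case/Kmaps_level => N; exact: closed_pdom_level. Qed.

Lemma Cc_lift s f : S s -> (forall x, pdom s x -> {for x, continuous f}) ->
  @Cc R K (lift s f).
Proof.
apply: Cc_germ_lift; [exact: infword_hausdorff|exact: infword_compact|exact: Kmaps_closed_dom].
Qed.

(** The bound holds for each C*-seminorm, hence for their supremum, which gives the norm of A on the
    image of [Cc]. *)
Lemma norm_iota_lift s f (M : R) : S s -> 0 < M ->
  (forall x, pdom s x -> {for x, continuous f}) ->
  (forall x, pdom s x -> `|f x| <= toC M) -> `|iota (lift s f)| <= toC M.
Proof.
move=> Ss M0 cf fM; have [_ _ _ nE _] := full.
rewrite -rnormE ler_toC -lee_fin nE; last exact: Cc_lift.
apply: ge_ereal_sup => _ [p sp <-]; rewrite lee_fin.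
apply: (seminorm_germ_lift _ _ _ _ sp) => //.
- exact: infword_hausdorff.
- exact: infword_compact.
- exact: Kmaps_closed_dom.
- exact: Kmaps_id.
Qed.

Lemma iota_linear c (a b : gp_arrow K -> C) : Cc a -> Cc b ->
  iota (c *: a + b) = c *: iota a + iota b.
Proof. by have [H _ _ _ _] := full; exact: H. Qed.

Lemma Cc0 : @Cc R K 0.
Proof.
exists 0%N, (fun=> 0), (fun=> 0); split => [[]//|].
by apply/funext => c; rewrite big_ord0.
Qed.

Lemma iota0 : iota 0 = 0.
Proof.
have := iota_linear 1 Cc0 Cc0; rewrite !scale1r addr0.
by move=> /(congr1 (fun b : A => b - iota 0)); rewrite addrK subrr => <-.
Qed.

Definition word_indic w x : C := (mkseq x (size w) == w)%:R.

Lemma word_indic_continuous w : continuous (word_indic w).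
Proof.
move=> x; apply: locally_cst_continuous.
by apply: filterS (nbhs_cylinder x (size w)) => y /= e; rewrite /word_indic e.
Qed.

Lemma lift_word_indic s w : S s ->
  lift s (word_indic w) = lift (pcomp s (word_id w)) (fun=> 1).
Proof.
move=> Ss; have Sw := Kmaps_word_id G w; apply/esym/eq_germ_lift => c x g.
  have [_ dx _] := g; have xw : mkseq x (size w) = w.
    by move: dx; rewrite /pdom /pcomp /word_id /=; case: eqP.
  split; last by rewrite /word_indic xw eqxx.
  exists x; apply: (is_germ_agree g Ss).
  have nw : \forall y \near x, mkseq y (size w) = w.
    by apply: filterS (nbhs_cylinder x (size w)) => y /= ->.
  have sx : pdom s x by move: dx; rewrite /pdom /pcomp /word_id /= xw eqxx.
  apply: filterS2 nw (near_pdom Ss sx) => y yw sy.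
  by rewrite /pcomp /word_id yw eqxx.
rewrite /word_indic; case: eqP => // xw _; exists x.
apply: (is_germ_agree g (pg_comp Sw Ss)); have [_ sx _] := g.
have nw : \forall y \near x, mkseq y (size w) = w.
  by apply: filterS (nbhs_cylinder x (size w)) => y /= ->.
apply: filterS2 nw (near_pdom Ss sx) => y yw sy.
by rewrite /pcomp /word_id yw eqxx.
Qed.

Definition bisection_elt s : A := iota (lift s (fun=> 1)).
Local Notation el := bisection_elt.

Section DenseInduction.
Variable Q : A -> Prop.
Hypotheses (Q0 : Q 0) (Q_lin : forall c a b, Q a -> Q b -> Q (c *: a + b))
  (Q_lim : forall a, (forall e : R, 0 < e -> exists2 b, Q b & `|a - b| <= toC e) -> Q a)
  (Q_el : forall s, S s -> Q (el s)).

Lemma dense_ind_step s (l : seq (seq X)) (k : seq X -> C) : S s ->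
  Q (iota (lift s (fun x => \sum_(w <- l) k w * word_indic w x))) /\
  (forall x, {for x, continuous (fun x => \sum_(w <- l) k w * word_indic w x)}).
Proof.
move=> Ss; elim: l => [|w l [IHQ IHc]].
  split; last first.
    move=> x; apply: locally_cst_continuous; apply/nbhs_infwordP.
    by exists 0%N => y _; rewrite !big_nil.
  rewrite (_ : lift _ _ = 0); last first.
    by apply/funext => c; rewrite /germ_lift big_nil if_same.
  by rewrite iota0.
have E : (fun x => \sum_(v <- w :: l) k v * word_indic v x) =
    (fun x => k w * word_indic w x + \sum_(v <- l) k v * word_indic v x).
  by apply/funext => x; rewrite big_cons.
rewrite E; split; last first.
  by move=> x; exact: (@axpy_continuous R _ (k w) _ _ x (@word_indic_continuous w x) (IHc x)).
rewrite germ_lift_linear iota_linear.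
- apply: Q_lin; last exact: IHQ.
  rewrite (lift_word_indic _ Ss); apply: Q_el.
  exact: pg_comp (Kmaps_word_id G w) Ss.
- by apply: (Cc_lift Ss) => x _; exact: word_indic_continuous.
- by apply: (Cc_lift Ss) => x _; exact: IHc.
Qed.

(** By compactness f is uniformly close, on the domain of [s], to a combination of indicators of
    cylinders; [norm_iota_lift] turns this into closeness in norm. *)
Lemma dense_ind_lift s f : S s -> (forall x, pdom s x -> {for x, continuous f}) ->
  Q (iota (lift s f)).
Proof.
move=> Ss cf; apply: Q_lim => e e0.
(* Extending f by 0 is harmless: the domain is a union of cylinders of one level, so [f0] is locally
   constant outside it. *)
pose f0 x : C := if s x is Some _ then f x else 0.
have f0E : lift s f = lift s f0.
  apply: eq_germ_lift => c x g; last by move=> _; exists x.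
  by split; [exists x|have [_ + _] := g; rewrite /f0 /pdom /=; case: (s x)].
have [M sM] := Kmaps_level Ss.
have [|x|N NP] := @fan_theorem X (fun w => forall x y, cylinder w x -> cylinder w y ->
    `|f0 x - f0 y| <= toC e).
- by move=> u v H x y /cylinder_cat xu /cylinder_cat yu; exact: H.
- have [sx|sx] := pselect (pdom s x); last first.
    exists M => y z; rewrite /cylinder /= size_mkseq.
    have s0 y' : mkseq y' M = mkseq x M -> f0 y' = 0.
      rewrite /f0; case sy: (s y') => [y''|] // e'; exfalso; apply: sx.
      by rewrite /pdom /=; have [? -> _] := sM _ (leqnn _) _ _ _ sy (esym e').
    by move=> /s0 -> /s0 ->; rewrite subrr normr0 toC_ge0 ltW.
  have e2 : 0 < toC (e / 2) by rewrite toC_gt0 divr_gt0.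
  have /cvgrPdist_lt/(_ _ e2) := cf _ sx.
  move=> /(filterI (near_pdom Ss sx))/nbhs_infwordP[m mP].
  have H y : cylinder (mkseq x m) y -> `|f0 x - f0 y| < toC (e / 2).
    rewrite /cylinder /= size_mkseq => /mP[/= sy].
    by rewrite /f0; move: sx sy; rewrite /pdom /=; case: (s x) => // ? _; case: (s y).
  exists m => y z /H xy /H xz.
  rewrite -(subrKA (f0 x)) (le_trans (ler_normD _ _)) // [e]splitr toCD.
  by apply: lerD; apply: ltW; rewrite // distrC.
pose x0 w : Y := infcat w (fun=> a0).
pose g x := \sum_(w <- words X N) f0 (x0 w) * word_indic w x.
have [Qg cg] := @dense_ind_step s (words X N) (fun w => f0 (x0 w)) Ss.
exists (iota (lift s g)) => //.
have -> : iota (lift s f) - iota (lift s g) = iota (lift s (fun x => - 1 * g x + f x)).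
  rewrite germ_lift_linear iota_linear.
  - by rewrite scaleN1r addrC.
  - by apply: (Cc_lift Ss) => x _; exact: cg.
  - exact: (Cc_lift Ss cf).
apply: (norm_iota_lift Ss e0) => x sx.
  exact: (@axpy_continuous R _ (-1) _ _ x (cg x) (cf x sx)).
have -> : g x = f0 (x0 (mkseq x N)).
  rewrite /g (bigD1_seq (mkseq x N)) ?uniq_words ?mem_words ?size_mkseq //=.
  rewrite {1}/word_indic size_mkseq eqxx mulr1 big1_seq ?addr0 // => w /andP[wx].
  rewrite mem_words => /eqP sw; rewrite /word_indic sw.
  by rewrite eq_sym (negbTE wx) mulr0.
have -> : f x = f0 x by move: sx; rewrite /f0 /pdom /=; case: (s x).
rewrite mulN1r addrC; apply: (NP (mkseq x N)); rewrite ?size_mkseq //.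
  exact: cylinder_mkseq.
by rewrite /cylinder /x0 /= infcat_prefix.
Qed.

(** * Functions with compact support in a Hausdorff open set *)

Section CompactSupport.
Variable U : set (germ P).
Hypotheses (oU : open U) (hausU : hausdorff_space (set_type U)).

(* This may fail at points outside a Hausdorff open set, as the groupoid of germs
   need not be Hausdorff. *)
Lemma bisection_clopen s c : S s -> bisection s `<=` U -> U c ->
  ~ bisection s c -> \forall d \near c, ~ bisection s d.
Proof.
move=> Ss sU Uc sc; have [t [x gt]] := is_germ_ex c; have [St tx _] := gt.
have [sx|sx] := pselect (pdom s x); last first.
  apply/(nbhs_germ _ gt).
  have nx : \forall y \near x, (~` pdom s) y.
    by apply: open_nbhs_nbhs; split => //; rewrite openC; exact: Kmaps_closed_dom.
  apply: filterS2 nx (near_pdom St tx) => y nsy ty; split=> // d gd [y' gd'].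
  have [e _] := is_germ_near gd gd'; subst y'.
  by apply: nsy; case: gd'.
(* The germ d of s at x lies in U and differs from c. Disjoint neighbourhoods of the two, read on
   the base, show that s and t have different germs at all points near x. *)
have [d gd] := mk_germ Ss sx.
have Ud : U d by apply: sU; exists x.
pose c' : set_type U := SigSub (mem_set Uc); pose d' : set_type U := SigSub (mem_set Ud).
have ncd : c' != d'.
  apply/eqP => /(congr1 set_val) /= cd; apply: sc; exists x.
  by rewrite [c]cd.
move: hausU; rewrite open_hausdorff => /(_ c' d' ncd)[[B D]] /= [/set_mem cB /set_mem dD].
case=> [[B' oB' BE] [D' oD' DE] BD].
have ncB : nbhs c B' by apply: open_nbhs_nbhs; split => //; move: cB; rewrite -BE.
have ndD : nbhs d D' by apply: open_nbhs_nbhs; split => //; move: dD; rewrite -DE.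
move/(nbhs_germ _ gt): ncB => ncB; move/(nbhs_germ _ gd): ndD => ndD.
apply/(nbhs_germ _ gt); apply: filterS2 ncB ndD => y [ty Bty] [sy Dsy].
split=> // h gh [y' gh']; have [e _] := is_germ_near gh gh'; subst y'.
have Uh : U h by apply: sU; exists y.
have : (B `&` D) (SigSub (mem_set Uh) : set_type U).
  by split; rewrite -?BE -?DE; [exact: Bty|exact: Dsy].
by move/eqP: BD => ->.
Qed.

(** In place of a partition of unity, h is cut along the bisections of the list one after the other.
    Cutting preserves continuity on U because [bisection s] is relatively clopen there. *)
Lemma dense_ind_cover (l : seq (Y -> option Y)) :
  (forall s, s \in l -> S s /\ bisection s `<=` U) ->
  forall h : germ P -> C, @is_continuous_compact_support R K U h ->
  (forall c, h c <> 0 -> exists2 s, s \in l & bisection s c) -> Q (iota h).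
Proof.
elim: l => [|s l IH] lU h [ch kh hU] hl.
  rewrite (_ : h = 0) ?iota0 //.
  by apply/funext => c; apply: contrapT => /hl[].
have [Ss sU] := lU _ (mem_head _ _).
pose h1 c : C := if `[< bisection s c >] then h c else 0.
pose h2 c : C := h c - h1 c.
have CcU k : @is_continuous_compact_support R K U k -> @Cc R K k.
  move=> H; exists 1%N, (fun=> 1), (fun=> k); split; last first.
    by apply/funext => c; rewrite big_ord1 mul1r.
  by move=> _; exists U.
have ch' c : U c -> {for c, continuous h}.
  by move: ch; have /continuous_open_subspace -> := oU => H /mem_set; exact: H.
have ch1 c : U c -> {for c, continuous h1}.
  move=> Uc; have [sc|sc] := pselect (bisection s c).
    apply: (@near_continuous (germ P) C h1 h c); last exact: ch'.
    have ns : nbhs c (bisection s) by apply: open_nbhs_nbhs; split => //; exact: open_bisection.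
    by apply: filterS ns => d sd; rewrite /h1 asboolT.
  apply: locally_cst_continuous.
  apply: filterS (bisection_clopen Ss sU Uc sc) => d sd.
  by rewrite /h1 !asboolF.
have sub2 c : h2 c <> 0 -> h c <> 0.
  by rewrite /h2 /h1; case: ifP => _; [rewrite subrr|rewrite subr0].
have H2 : @is_continuous_compact_support R K U h2.
  split=> [||c /hU hc].
  - have /continuous_open_subspace -> := oU => c /set_mem Uc.
    have E2 : h2 = fun d => - 1 * h1 d + h d by apply/funext => d; rewrite /h2 mulN1r addrC.
    by rewrite E2; exact: (@axpy_continuous R _ (-1) _ _ c (ch1 c Uc) (ch' c Uc)).
  - have -> : U `&` closure [set g | h2 g <> 0] =
        (U `&` closure [set g | h g <> 0]) `&` closure [set g | h2 g <> 0].
      apply/seteqP; split=> [c [Uc cc]|c [[]] //].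
      by split=> //; split=> //; exact: closure_subset cc.
    by apply: compact_closedI => //; exact: closed_closure.
  - by rewrite /h2 /h1 hc if_same subrr.
have Q2 : Q (iota h2).
  apply: IH => // [t tl|c hc]; first by apply: lU; rewrite inE tl orbT.
  have [t] := hl _ (sub2 _ hc); rewrite inE => /predU1P[->|tl] tc; last by exists t.
  by move: hc; rewrite /h2 /h1 asboolT // subrr.
pose f x : C := if pselect (pdom s x) is left sx then h (projT1 (cid (mk_germ Ss sx))) else 0.
have fE c x : is_germ c s x -> f x = h c.
  move=> g; rewrite /f; case: pselect => [sx|[]]; last by case: g.
  case: cid => d /= gd; congr h; exact: is_germ_inj gd g.
have h1E : h1 = lift s f.
  apply/funext => c; rewrite /h1 /germ_lift; case: asboolP => // -[x g].
  by rewrite (is_germ_source g) (fE _ _ g).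
have cf x : pdom s x -> {for x, continuous f}.
  move=> sx; have [c g] := mk_germ Ss sx.
  move=> V; rewrite (fE _ _ g) => nV.
  have Uc : U c by apply: sU; exists x.
  have nhV : nbhs c (h @^-1` V) := ch' _ Uc _ nV.
  move/(nbhs_germ _ g): nhV => H.
  suff : \forall y \near x, V (f y) by [].
  apply: filterS H => y [sy Hy]; have [d gd] := mk_germ Ss sy.
  by rewrite (fE _ _ gd); exact: Hy.
have -> : h = 1 *: h1 + h2.
  by apply/funext => c; rewrite scale1r -[RHS]/(h1 c + (h c - h1 c)) addrC subrK.
rewrite iota_linear; last exact: CcU.
  by apply: Q_lin; [rewrite h1E; exact: (dense_ind_lift Ss cf)|exact: Q2].
by rewrite h1E; exact: (Cc_lift Ss cf).
Qed.

Lemma dense_ind_compact_support h : @is_continuous_compact_support R K U h -> Q (iota h).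
Proof.
move=> H; have [_ /compact_near_coveringP cov hU] := H.
(* [F] is the filter of all large finite lists; a near covering along it yields one finite list of
   bisections that covers the support. *)
pose F : set_system (seq (Y -> option Y)) :=
  [set B : set (seq (Y -> option Y)) |
    exists l0 : seq (Y -> option Y), forall l, {subset l0 <= l} -> B l].
have FF : Filter F.
  split; first by exists [::].
    move=> B B' [l Bl] [l' Bl']; exists (l ++ l') => m lm; split.
      by apply: Bl => s sl; apply: lm; rewrite mem_cat sl.
    by apply: Bl' => s sl; apply: lm; rewrite mem_cat sl orbT.
  by move=> B B' BB' [l Bl]; exists l => m /Bl /BB'.
pose good s := S s /\ bisection s `<=` U.
have := cov _ F (fun l c => exists s, [/\ s \in l, good s & bisection s c]) FF.
case=> [c [Uc _]|l lP].
  have [t [x gt]] := is_germ_ex c; have [St tx _] := gt.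
  have nU : nbhs c U by apply: open_nbhs_nbhs; split.
  move/(nbhs_germ _ gt): nU => /nbhs_infwordP[m mP].
  pose w := mkseq x m; have Sw := Kmaps_word_id G w.
  pose s := pcomp t (word_id w).
  have Ss : S s by apply: pg_comp.
  have sE y : mkseq y m = w -> s y = t y.
    by move=> e; rewrite /s /pcomp /word_id size_mkseq e eqxx.
  have sdom y : pdom s y -> mkseq y m = w.
    by rewrite /pdom /s /pcomp /word_id /= size_mkseq; case: eqP.
  have gs : is_germ c s x.
    apply: (is_germ_agree gt Ss).
    by apply/nbhs_infwordP; exists m => y e; rewrite sE //; have [] := mP _ e.
  have sU : bisection s `<=` U.
    move=> d [y gd]; have [_ /sdom yw _] := gd.
    have [ty Hy] := mP _ yw; apply: Hy; apply: (is_germ_agree gd St).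
    apply/nbhs_infwordP; exists m => z e; have zw : mkseq z m = w by rewrite e yw.
    by have [tz _] := mP z zw; rewrite sE.
  exists (bisection s, [set l : seq (Y -> option Y) | s \in l]) => /=; last first.
    by move=> [d l] /= [sd sl]; exists s.
  split; last by exists [:: s] => l; apply; rewrite mem_head.
  by apply: open_nbhs_nbhs; split; [exact: open_bisection|exists x].
have {}lP := lP l (fun _ => id).
apply: (@dense_ind_cover [seq s <- l | `[< good s >]]) => //.
  by move=> s; rewrite mem_filter => /andP[/asboolP].
move=> c hc; have [|s [sl sg sc]] := lP c; last first.
  by exists s => //; rewrite mem_filter sl andbT; apply/asboolP.
split; first by apply: contrapT => /hU.
by apply: subset_closure.
Qed.

End CompactSupport.

(** This is the density of the span of the 1_s, in the form of an induction principle that serves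
    for identities in A as well as for the convergence of averages. *)
Lemma dense_ind a : Q a.
Proof.
have [_ _ _ _ dn] := full.
apply: Q_lim => e e0.
have e0' : 0 < toC e by rewrite toC_gt0.
have [||b [/interior_subset + [f Cf fb]]] := dn (interior (ball a (toC e))).
- by exists a; exact: nbhsx_ballx.
- exact: open_interior.
rewrite -fb => ab; exists (iota f); last first.
  by apply: ltW; move: ab; rewrite -ball_normE.
move: Cf => [n [c [h [hU ->]]]].
have : forall m (c : 'I_m -> C) (h : 'I_m -> germ P -> C),
    (forall i, exists U : set (germ P), [/\ open U, hausdorff_space (set_type U) &
       @is_continuous_compact_support R K U (h i)]) ->
    Q (iota (fun g => \sum_(i < m) c i * h i g)).
  elim=> [|m IH] c' h' hU'.
    rewrite (_ : (fun g => _) = 0) ?iota0 //.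
    by apply/funext => d; rewrite big_ord0.
  have -> : (fun g => \sum_(i < m.+1) c' i * h' i g) =
      c' ord0 *: h' ord0 +
      (fun g => \sum_(i < m) c' (fintype.lift ord0 i) * h' (fintype.lift ord0 i) g).
    by apply/funext => d; rewrite big_ord_recl.
  have [U [oU hausU H]] := hU' ord0.
  rewrite iota_linear.
  - by apply: Q_lin; [exact: (dense_ind_compact_support oU hausU H)|apply: IH => i; exact: hU'].
  - exists 1%N, (fun=> 1), (fun=> h' ord0); split; last first.
      by apply/funext => d; rewrite big_ord1 mul1r.
    by move=> _; exists U.
  - exists m, (fun i => c' (fintype.lift ord0 i)), (fun i => h' (fintype.lift ord0 i)); by split.
by apply.
Qed.

End DenseInduction.
End FullAlgebra.

(** * Traces on the full C*-algebra *)

Section PositiveFunctional.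
Variables (R : realType) (A : cstar_algebra R).
Local Notation C := (Cx R).
Implicit Types (a b p : A) (c : C).

Lemma norm_le_eps (V : normedZmodType C) (x : V) :
  (forall e : R, 0 < e -> `|x| <= toC e) -> x = 0.
Proof.
have xE : toC (complex.Re `|x|) = `|x| by exact: Re_ge0.
move=> H; apply/eqP; rewrite -normr_eq0 -xE -toC0.
apply/eqP; congr toC; apply/eqP; rewrite eq_le; apply/andP; split.
  by apply/ler_addgt0Pr => e e0; rewrite add0r -ler_toC xE H.
by rewrite -toC_ge0 xE.
Qed.

Variable sigma : A -> C.
Hypothesis lin : forall c a b, sigma (c *: a + b) = c * sigma a + sigma b.
Hypothesis pos : forall a, 0 <= sigma (cs_mul (cs_star a) a).

Lemma functional0 : sigma 0 = 0.
Proof.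
have /(congr1 (fun z => z - sigma 0)) := lin 1 0 0.
by rewrite scale1r addr0 mul1r addrK subrr => <-.
Qed.

Lemma functionalZ c a : sigma (c *: a) = c * sigma a.
Proof. by rewrite -[c *: a]addr0 lin functional0 addr0. Qed.

Lemma functionalD a b : sigma (a + b) = sigma a + sigma b.
Proof. by rewrite -[in LHS](scale1r a) lin mul1r. Qed.

Lemma functionalB a b : sigma (a - b) = sigma a - sigma b.
Proof. by rewrite addrC -scaleN1r lin mulN1r addrC. Qed.

Lemma functional_sum I (r : seq I) (F : I -> A) :
  sigma (\sum_(i <- r) F i) = \sum_(i <- r) sigma (F i).
Proof.
elim: r => [|i r IH]; first by rewrite !big_nil functional0.
by rewrite !big_cons functionalD IH.
Qed.

Lemma positive_expand p b c : 0 <=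
  sigma (cs_mul (cs_star p) p) + c * sigma (cs_mul (cs_star p) b) +
  c^* * sigma (cs_mul (cs_star b) p) + c^* * c * sigma (cs_mul (cs_star b) b).
Proof.
have := pos (c *: b + p).
rewrite cs_starD cs_starZ cs_mulDl !cs_mulDr !cs_mulZl !cs_mulZr.
rewrite !functionalD !functionalZ.
by congr (_ <= _); ring.
Qed.

(** The order of the complex numbers includes reality: the inequalities force x to be real and then
    bound it from both sides. *)
Lemma norm_le_two_sided (x M : C) : 0 <= M -> 0 <= M + x -> 0 <= M - x -> `|x| <= M.
Proof.
move=> M0 h1 h2; have xr : x \is Num.real.
  by rewrite -[x](addKr M); apply: rpredD; [rewrite rpredN|]; apply: ger0_real.
rewrite real_ler_norml //; apply/andP; split; last by rewrite -subr_ge0.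
by rewrite -subr_ge0 opprK addrC.
Qed.

(** The scalars 1, -1, i and -i suffice: they bound alpha + beta and alpha - beta, and alpha is the
    mean of the two. In the applications alpha is the value of a positive functional at an element
    and beta its value at the adjoint. *)
Lemma norm_le_polar (alpha beta M : C) : 0 <= M ->
  (forall c : C, c^* * c = 1 -> 0 <= M + (c * alpha + c^* * beta)) -> `|alpha| <= M.
Proof.
move=> M0 H.
have H1 : `|alpha + beta| <= M.
  apply: norm_le_two_sided => //.
    by have := H 1; rewrite conjC1 !mul1r; exact.
  have := H (-1); rewrite rmorphN /= conjC1 mulrNN mulr1 !mulN1r -opprD.
  by exact.
have H2 : `|alpha - beta| <= M.
  have -> : `|alpha - beta| = `|'i * alpha - 'i * beta|.
    by rewrite -mulrBr normrM normCi mul1r.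
  apply: norm_le_two_sided => //.
    have := H 'i; rewrite conjCi mulNr -expr2 sqrCi opprK mulNr.
    by exact.
  have := H (- 'i); rewrite rmorphN /= conjCi opprK mulrN -expr2 sqrCi opprK mulNr.
  by rewrite opprB [- _ + _]addrC; exact.
have -> : alpha = 2^-1 * ((alpha + beta) + (alpha - beta)).
  by field.
rewrite normrM ger0_norm ?invr_ge0 ?ler0n // mulrC ler_pdivrMr ?ltr0n //.
apply: le_trans (ler_normD _ _) _; rewrite -[2]/(1 + 1) mulrDr mulr1.
exact: lerD.
Qed.

(* [sigma ((one + c a)^* (one + c a)) >= 0] for every scalar c. *)
Lemma functional_null (one : A) a : cs_star one = one ->
  cs_mul one one = one -> cs_mul one a = a -> cs_mul (cs_star a) one = cs_star a ->
  sigma (cs_mul (cs_star a) a) = 0 -> sigma a = 0.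
Proof.
move=> so oo oa ao a0; apply: norm_le_eps => e e0.
have s1 : 0 <= sigma one by have := pos one; rewrite so oo.
(* The scale t makes sigma(1) / t smaller than e; multiplying a by t preserves the vanishing of
   sigma at a^* a. *)
pose t : R := (complex.Re (sigma one) + 1) / e.
have s1' : 0 < complex.Re (sigma one) + 1.
  by rewrite ltr_wpDl // -toC_ge0 Re_ge0.
have t0 : 0 < t by rewrite divr_gt0.
suff : `|sigma (toC t *: a)| <= sigma one.
  rewrite functionalZ normrM norm_toC (gtr0_norm t0) => H.
  rewrite -(ler_pM2l (_ : 0 < toC t)) ?toC_gt0 //.
  apply: le_trans H _; rewrite -toCM /t divfK ?gt_eqF // toCD Re_ge0 //.
  by rewrite lerDl toC1 ler01.
apply: (@norm_le_polar _ (sigma (cs_star (toC t *: a)))) => // c cc.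
have := positive_expand one (toC t *: a) c.
rewrite so oo cs_starZ !cs_mulZl !cs_mulZr oa ao !functionalZ a0 !mulr0 addr0.
by rewrite addrA.
Qed.

Hypothesis tr : forall a b, sigma (cs_mul a b) = sigma (cs_mul b a).

(* [sigma ((p + c b)^* (p + c b)) >= 0] for every scalar c of modulus one. *)
Lemma trace_partial_isometry p b : cs_star p = p -> cs_mul p p = p ->
  cs_mul b p = b -> cs_mul (cs_star b) b = p -> `|sigma b| <= 2 * sigma p.
Proof.
move=> sp pp bp bb; have p0 : 0 <= sigma p by have := pos p; rewrite sp pp.
apply: (@norm_le_polar _ (sigma (cs_star b))); first by rewrite mulr_ge0 ?ler0n.
move=> c cc; have := positive_expand p b c.
rewrite cc mul1r bb sp pp tr bp (tr (cs_star b) p).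
have -> : cs_mul p (cs_star b) = cs_star b by rewrite -[p in cs_mul p _]sp -cs_starM bp.
by congr (_ <= _); ring.
Qed.

End PositiveFunctional.

(** * Relations among the 1_s and the values of traces on them *)

Section Relations.
Variables (X : finType) (a0 : X) (G : self_similar_group X) (R : realType).
Local Notation Y := (infword X).
Local Notation P := (Kpseudogroup G).
Local Notation S := (pg_maps P).
Local Notation C := (Cx R).
Local Notation lift := (@germ_lift Y P R).
Local Notation K := (Kgroupoid G).
Implicit Types (s t : Y -> option Y) (u v w : seq X) (x y z : Y) (f : Y -> C).
Variables (A : cstar_algebra R) (iota : (gp_arrow K -> C) -> A).
Hypothesis full : is_full_cstar iota.
Local Notation el := (bisection_elt iota).
Local Notation one := (el Some).

Lemma Cc_el s : S s -> @Cc R K (lift s (fun=> 1)).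
Proof. by move=> Ss; apply: Cc_lift => // x _; apply: locally_cst_continuous; exact: filterE. Qed.

Lemma el_mul s t : S s -> S t -> cs_mul (el s) (el t) = el (pcomp s t).
Proof.
move=> Ss St; have [_ H _ _ _] := full.
rewrite -H; [|exact: Cc_el|exact: Cc_el].
rewrite convolution_germ_lift //; congr iota.
apply: eq_germ_lift => c x g; last by move=> _; exists x.
split; first by exists x.
have [_ + _] := g; rewrite /pdom /pcomp /=.
by case: (t x) => //= y _; rewrite mulr1.
Qed.

Lemma el_star s t : S s -> S t -> pinverse s t -> cs_star (el s) = el t.
Proof.
move=> Ss St st; have [_ _ H _ _] := full.
rewrite -H; last exact: Cc_el.
rewrite (Cc_star_germ_lift _ Ss St st); congr iota.
apply: eq_germ_lift => c x g; last by move=> _; exists x.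
split; first by exists x.
have [_ + _] := g; rewrite /pdom /=.
by case: (t x) => //= y _; rewrite conjC1.
Qed.

Lemma norm_el s : S s -> `|el s| <= 1.
Proof.
move=> Ss; rewrite -(toC1 R); apply: (norm_iota_lift full Ss) => // x _.
  by apply: locally_cst_continuous; exact: filterE.
by rewrite normr1 toC1.
Qed.

Lemma el_none : el (fun=> None) = 0.
Proof.
rewrite /bisection_elt; have -> : lift (fun=> None) (fun=> 1) = 0.
  by apply/funext => c; rewrite germ_lift_out // => -[x [_ /=]]; rewrite /pdom /=.
exact: (iota0 full).
Qed.

Lemma el_one_star : cs_star one = one.
Proof. by apply: el_star; [exact: Kmaps_id|exact: Kmaps_id|move=> x y; split=> -[->]]. Qed.

(** The algebra A is not given with a unit. By density it suffices that 1 is neutral on the 1_s, and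
    [norm_el] carries this over to limits. *)
Lemma el_one_mul a : cs_mul one a = a.
Proof.
apply: (dense_ind a0 full (Q := fun a => cs_mul one a = a)).
- by rewrite -(scale0r (0 : A)) cs_mulZr !scale0r.
- by move=> c b b' Hb Hb'; rewrite cs_mulDr cs_mulZr Hb Hb'.
- move=> b Hb; apply/eqP; rewrite -subr_eq0; apply/eqP/norm_le_eps => e e0.
  have [d dd bd] := Hb (e / 2) (divr_gt0 e0 (ltr0n _ 2)).
  have -> : cs_mul one b - b = cs_mul one (b - d) - (b - d).
    have -> : cs_mul one (b - d) = cs_mul one b - d.
      by rewrite -scaleN1r cs_mulDr cs_mulZr dd scaleN1r.
    by rewrite opprB addrA subrK.
  apply: le_trans (ler_normB _ _) _; rewrite [e]splitr toCD.
  apply: lerD => //; apply: le_trans (cs_normM _ _) _.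
  apply: le_trans bd; rewrite -[leRHS]mul1r ler_wpM2r //.
  by apply: norm_el; exact: Kmaps_id.
- move=> s Ss; rewrite (el_mul (Kmaps_id G) Ss); congr (bisection_elt iota _).
  by apply/funext => x; rewrite /pcomp; case: (s x).
Qed.

Lemma el_mul_one a : cs_mul a one = a.
Proof.
by rewrite -[LHS]cs_starK cs_starM el_one_star el_one_mul cs_starK.
Qed.

Lemma functional_ext (F F' : A -> C) (M : R) : 0 < M ->
  (forall c a b, F (c *: a + b) = c * F a + F b) ->
  (forall c a b, F' (c *: a + b) = c * F' a + F' b) ->
  (forall a, `|F a| <= toC M * `|a|) -> (forall a, `|F' a| <= toC M * `|a|) ->
  (forall s, S s -> F (el s) = F' (el s)) -> forall a, F a = F' a.
Proof.
move=> M0 lF lF' bF bF' FF'; apply: (dense_ind a0 full) => //.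
- by rewrite (functional0 lF) (functional0 lF').
- by move=> c a b; rewrite lF lF' => -> ->.
move=> a Ha; apply/eqP; rewrite -subr_eq0; apply/eqP/norm_le_eps => e e0.
have [|b Fb ab] := Ha (e / 2 / M); first by rewrite !divr_gt0.
have -> : F a - F' a = F (a - b) - F' (a - b).
  by rewrite (functionalB lF) (functionalB lF') Fb opprB addrA subrK.
apply: le_trans (ler_normB _ _) _; rewrite [e]splitr toCD.
have H : toC M * `|a - b| <= toC (e / 2).
  rewrite -[in leRHS](divfK (lt0r_neq0 M0) (e / 2)) toCM [leRHS]mulrC ler_wpM2l //.
  by rewrite toC_ge0 ltW.
by apply: lerD; [apply: le_trans (bF _) H|apply: le_trans (bF' _) H].
Qed.

Lemma sum_word_indic n x : \sum_(w <- words X n) word_indic R w x = 1.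
Proof.
rewrite (bigD1_seq (mkseq x n)) ?uniq_words ?mem_words ?size_mkseq //=.
rewrite {1}/word_indic size_mkseq eqxx big1_seq ?addr0 // => w /andP[wx].
rewrite mem_words => /eqP sw; rewrite /word_indic sw.
by rewrite eq_sym (negbTE wx).
Qed.

Lemma el_split n s : S s -> el s = \sum_(w <- words X n) el (pcomp s (word_id w)).
Proof.
move=> Ss; rewrite {1}/bisection_elt.
have -> : (fun=> 1) = (fun x : Y => \sum_(w <- words X n) word_indic R w x).
  by apply/funext => x; rewrite sum_word_indic.
elim: (words X n) => [|w l IH].
  rewrite big_nil -el_none; congr iota; apply/funext => c.
  rewrite [RHS]germ_lift_out /germ_lift ?big_nil ?if_same // => -[x [_ /=]].
  by rewrite /pdom /=.
have cl l' : forall x : Y, {for x, continuous (fun x : Y => \sum_(w <- l') word_indic R w x)}.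
  elim: l' => [|v l' IHl] x.
    by apply: locally_cst_continuous; apply/nbhs_infwordP; exists 0%N => y _; rewrite !big_nil.
  have -> : (fun x : Y => \sum_(w <- v :: l') word_indic R w x) =
      (fun x => 1 * word_indic R v x + \sum_(w <- l') word_indic R w x).
    by apply/funext => z; rewrite big_cons mul1r.
  exact: (@axpy_continuous R Y 1 _ _ x (@word_indic_continuous X R v x) (IHl x)).
rewrite [RHS]big_cons -IH.
have -> : (fun x : Y => \sum_(v <- w :: l) word_indic R v x) =
    (fun x => 1 * word_indic R w x + \sum_(v <- l) word_indic R v x).
  by apply/funext => x; rewrite big_cons mul1r.
rewrite germ_lift_linear (iota_linear full).
- by rewrite scale1r (lift_word_indic _ _ Ss).
- by apply: (Cc_lift Ss) => x _; exact: word_indic_continuous.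
- by apply: (Cc_lift Ss) => x _; exact: cl.
Qed.

Section Trace.
Variable sigma : A -> C.
Hypothesis lin : forall c a b, sigma (c *: a + b) = c * sigma a + sigma b.
Hypothesis pos : forall a, 0 <= sigma (cs_mul (cs_star a) a).
Hypothesis tr : forall a b, sigma (cs_mul a b) = sigma (cs_mul b a).

Lemma word_id_inverse w : pinverse (word_id w) (word_id w).
Proof.
move=> x y; rewrite /word_id; split; case: eqP => // e [<-]; by rewrite e eqxx.
Qed.

Lemma word_id_idem w : pcomp (word_id w) (word_id w) = word_id w.
Proof.
apply/funext => x; rewrite /pcomp /word_id; case: eqP => //= ->.
by rewrite eqxx.
Qed.

(** The swap is a partial isometry whose source and range projections belong to the cylinders of v
    and u, so a trace takes the same value on both. *)
Lemma trace_word_swap u v : size u = size v ->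
  sigma (el (word_id u)) = sigma (el (word_id v)).
Proof.
move=> uv; have S1 := Kmaps_swap G uv; have S2 := Kmaps_swap G (esym uv).
have swapK u' v' : size u' = size v' ->
    pcomp (word_swap u' v') (word_swap v' u') = word_id u'.
  move=> e; apply/funext => x; rewrite /pcomp /word_swap /word_id.
  case: eqP => // xu /=; rewrite infcat_prefix eqxx infdrop_cat.
  by congr Some; rewrite -[in LHS]xu size_mkseq infcat_drop.
by rewrite -(swapK u v) // -(swapK v u) // -!el_mul // tr.
Qed.

(** The cylinders of level |w| give |X|^|w| equivalent projections with sum 1. *)
Lemma trace_word_id w :
  sigma (el (word_id w)) * (#|X| ^ size w)%:R = sigma one.
Proof.
rewrite (el_split (size w) (Kmaps_id G)) (functional_sum lin).
rewrite (eq_big_seq (fun=> sigma (el (word_id w)))) => [|v].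
  by rewrite big_const_seq count_predT iter_addr_0 size_words mulr_natr.
rewrite mem_words => /eqP vw; rewrite -(trace_word_swap vw).
by congr (sigma (el _)); apply/funext => x; rewrite /pcomp; case: word_id.
Qed.

Lemma trace_el s : S s -> exists N, forall n, (N <= n)%N ->
  `|sigma (el s) * (#|X| ^ n)%:R - sigma one * (count (fixing s) (words X n))%:R|
    <= 2 * sigma one * (count (bad s) (words X n))%:R.
Proof.
move=> Ss; have [N sN] := Kmaps_level Ss; exists N => n Nn.
pose T w := sigma (el (word_id w)).
have Tn w : w \in words X n -> T w * (#|X| ^ n)%:R = sigma one.
  by rewrite mem_words => /eqP <-; exact: trace_word_id.
have T0 w : 0 <= T w.
  have Sw := Kmaps_word_id G w.
  have := pos (el (word_id w)).
  by rewrite (el_star Sw Sw (@word_id_inverse w)) el_mul // word_id_idem.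
have key w : w \in words X n ->
    `|sigma (el (pcomp s (word_id w))) - T w * (fixing s w)%:R| <=
      2 * T w * (bad s w)%:R.
  rewrite mem_words => /eqP wn; have Sw := Kmaps_word_id G w.
  have Sr := pg_comp Sw Ss.
  rewrite /bad /fixing /returning; case: asboolP => [fw|nf] /=.
    rewrite mulr0 mulr1; have -> : pcomp s (word_id w) = word_id w.
      apply/funext => x; rewrite /pcomp /word_id; case: eqP => //= xw.
      exact: fw.
    by rewrite subrr normr0.
  rewrite mulr0 subr0; case: asboolP => [rw|nr] /=; last first.
    rewrite mulr0; have -> : sigma (el (pcomp s (word_id w))) = 0; last by rewrite normr0.
    (* The piece carries a factor 1_w on the right; the trace moves it to the left, where it kills
       the piece because no point returns to the cylinder. *)
    have <- : pcomp (pcomp s (word_id w)) (word_id w) = pcomp s (word_id w).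
      rewrite -[in RHS](word_id_idem w).
      by apply/funext => x; rewrite /pcomp; case: (word_id w x).
    rewrite -el_mul // tr el_mul // -(functional0 lin) -el_none.
    congr (sigma (el _)); apply/funext => x; rewrite /pcomp /word_id.
    case: eqP => //= xw; case sx: (s x) => [y|] //=; case: eqP => // yw.
    by exfalso; apply: nr; exists x, y.
  rewrite mulr1; have [x [y [xw sx yw]]] := rw.
  have [r' Sr' rr'] := pg_inv Sr.
  (* As n is beyond the level of s, one point of the cylinder in the domain brings in the entire
     cylinder, so the source projection of the piece is all of 1_w. *)
  have K1 : pcomp r' (pcomp s (word_id w)) = word_id w.
    apply/funext => z; rewrite {1}/pcomp.
    have rz : pcomp s (word_id w) z = if mkseq z (size w) == w then s z else None.
      by rewrite /pcomp /word_id; case: eqP.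
    rewrite rz /word_id; case: eqP => //= zw.
    have [|z' sz _] := sN _ Nn _ z _ sx; first by rewrite -wn zw xw.
    by rewrite sz /=; apply/rr'; rewrite rz zw eqxx.
  apply: trace_partial_isometry => //.
  - exact: (el_star Sw Sw (@word_id_inverse w)).
  - by rewrite el_mul // word_id_idem.
  - rewrite el_mul //; congr (bisection_elt iota _).
    apply/funext => z; rewrite /pcomp /word_id; case: eqP => //= zw.
    by rewrite zw eqxx.
  - by rewrite (el_star Sr Sr' rr') el_mul // K1.
rewrite (el_split n Ss) (functional_sum lin) !count_words_sum mulr_suml !mulr_sumr -sumrB.
apply: le_trans (ler_norm_sum _ _ _) _; rewrite !big_seq.
apply: ler_sum => w wn; rewrite -(Tn w wn).
set N' := (#|X| ^ n)%:R; have N'0 : 0 <= N' :> C by rewrite ler0n.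
have -> (z f : C) : z * N' - T w * N' * f = (z - T w * f) * N' by ring.
have -> (f : C) : 2 * (T w * N') * f = 2 * T w * f * N' by ring.
by rewrite normrM (ger0_norm N'0) ler_wpM2r // key.
Qed.

End Trace.
End Relations.

(** * The trace given by Riemann sums *)

Section ComplexLimits.
Variable R : realType.
Local Notation C := (Cx R).

Lemma complex_cauchy (u : nat -> C) :
  (forall e : R, 0 < e -> exists N, forall n m, (N <= n)%N -> (N <= m)%N ->
    `|u n - u m| <= toC e) ->
  exists l, forall e : R, 0 < e -> exists N, forall n, (N <= n)%N -> `|u n - l| <= toC e.
Proof.
move=> H.
have real_case (r : nat -> R) :
    (forall e : R, 0 < e -> exists N, forall n m, (N <= n)%N -> (N <= m)%N ->
      `|r n - r m| <= e) ->
    exists l, forall e : R, 0 < e -> exists N, forall n, (N <= n)%N -> `|r n - l| <= e.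
  move=> Hr; have /cauchy_cvgP : cauchy (r @ \oo).
    apply: cauchy_exP => e e0; have [N NP] := Hr _ (divr_gt0 e0 (ltr0n _ 2)).
    exists (r N); exists N => // n /= Nn.
    rewrite /ball /= (le_lt_trans (NP _ _ (leqnn N) Nn)) //.
    by rewrite ltr_pdivrMr ?ltr0n // ltr_pMr // ltr1n.
  move=> /cvg_ex[l /cvgrPdist_le rl]; exists l => e e0.
  by have [N _ NP] := rl _ e0; exists N => n /NP; rewrite distrC.
have Re_case (f : C -> R) : (forall z w, f (z - w) = f z - f w) ->
    (forall z, `|f z| <= complex.Re `|z|) ->
    exists l, forall e : R, 0 < e -> exists N, forall n, (N <= n)%N -> `|f (u n) - l| <= e.
  move=> fB fn; apply: real_case => e e0; have [N NP] := H _ e0; exists N => n m Nn Nm.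
  by rewrite -fB (le_trans (fn _)) // -ler_toC Re_norm NP.
have [|a aP] := @Re_case (@complex.Re R) _ (@norm_Re_le R).
  by move=> z w; rewrite ReD ReN.
have [|z|b bP] := @Re_case (@complex.Im R).
- by case=> [? ?] [? ?].
- case: z => x y; rewrite /= -sqrtr_sqr; apply: ler_wsqrtr.
  by rewrite lerDr sqr_ge0.
exists (toC a + 'i * toC b) => e e0.
have [N NP] := aP _ (divr_gt0 e0 (ltr0n _ 2)).
have [M MP] := bP _ (divr_gt0 e0 (ltr0n _ 2)).
exists (maxn N M) => n; rewrite geq_max => /andP[/NP Nn /MP Mn].
have -> : u n - (toC a + 'i * toC b) =
    toC (complex.Re (u n) - a) + 'i * toC (complex.Im (u n) - b).
  have {1}-> : u n = toC (complex.Re (u n)) + 'i * toC (complex.Im (u n)).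
    have -> : ('i : C) = 'i%C by [].
    exact: complexE.
  by rewrite !toCD !toCN; ring.
apply: le_trans (ler_normD _ _) _; rewrite [e]splitr (toCD (e / 2)) normrM normCi mul1r.
by rewrite !norm_toC; apply: lerD; rewrite ler_toC.
Qed.

Lemma limit_ge0 (l : C) :
  (forall e : R, 0 < e -> exists2 z, 0 <= z & `|z - l| <= toC e) -> 0 <= l.
Proof.
move=> H; suff -> : l = `|l| by [].
apply/eqP; rewrite -subr_eq0; apply/eqP/norm_le_eps => e e0.
have [z z0 zl] := H _ (divr_gt0 e0 (ltr0n _ 2)).
have -> : l - `|l| = (l - z) + (`|z| - `|l|) by rewrite (ger0_norm z0) addrA subrK.
apply: le_trans (ler_normD _ _) _; rewrite [e]splitr toCD.
apply: lerD; first by rewrite distrC.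
exact: le_trans (ler_dist_dist _ _) zl.
Qed.

End ComplexLimits.

(** * Baire category in the space of infinite words *)

Section Baire.
Variables (X : finType) (a0 : X).
Local Notation Y := (infword X).

(** Nested cylinders of growing length, each chosen inside the previous one and off the next [F n],
    shrink to a point outside all of them. *)
Lemma meagre_cylinder (M : set Y) w : meagre M -> exists2 x, cylinder w x & ~ M x.
Proof.
case=> F nF MF.
have step n v : exists v', (size v < size v')%N /\ cylinder v' `<=` cylinder v `\` F n.
  have [x xv xF] : exists2 x, cylinder v x & ~ closure (F n) x.
    apply: contrapT => H.
    have : interior (closure (F n)) (infcat v (fun=> a0)).
      apply: (@filterS _ _ _ (cylinder v)); last first.
        apply: open_nbhs_nbhs; split; first exact: open_cylinder.
        by rewrite /cylinder /= infcat_prefix.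
      by move=> x xv; apply: contrapT => nx; apply: H; exists x.
    by rewrite (nF n).
  have : nbhs x (~` closure (F n)).
    by apply: open_nbhs_nbhs; split => //; rewrite openC; exact: closed_closure.
  case/nbhs_infwordP => m mP; exists (mkseq x (maxn m (size v).+1)).
  rewrite size_mkseq leq_maxr; split=> // z; rewrite /cylinder /= size_mkseq => zx.
  split.
    rewrite /cylinder /= -[RHS]xv; apply: mkseq_le zx.
    by rewrite leq_max leqnSn orbT.
  move=> /subset_closure; apply: mP; apply: mkseq_le zx; exact: leq_maxl.
have {}step p : exists v', (size p.2 < size v')%N /\ cylinder v' `<=` cylinder p.2 `\` F p.1.
  exact: step.
have [f fP] := choice step.
pose v := fix v n := if n is n'.+1 then f (n', v n') else w.
have vS n : (size (v n) < size (v n.+1))%N /\ cylinder (v n.+1) `<=` cylinder (v n) `\` F n.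
  exact: (fP (n, v n)).
have size_v n : (n <= size (v n))%N.
  by elim: n => // n IH; apply: leq_ltn_trans IH (vS n).1.
have v_sub n k : cylinder (v (n + k)%N) `<=` cylinder (v n).
  elim: k => [|k IH]; first by rewrite addn0.
  by rewrite addnS => x /(vS _).2[/IH].
(* The letter of index n is read in [v n.+1], whose length exceeds n, so the default [a0] is not
   reached. *)
pose x : Y := fun n => nth a0 (v n.+1) n.
have vx n : cylinder (v n) x.
  rewrite /cylinder /=; apply: (@eq_from_nth _ a0); rewrite size_mkseq // => i iv.
  rewrite nth_mkseq // /x.
  pose z : Y := infcat (v (n + i.+1)%N) (fun=> a0).
  have zz : cylinder (v (n + i.+1)%N) z by rewrite /cylinder /= infcat_prefix.
  have z1 : mkseq z (size (v n)) = v n := v_sub n i.+1 _ zz.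
  have z2 : mkseq z (size (v i.+1)) = v i.+1.
    by apply: (v_sub i.+1 n); rewrite addnC.
  by rewrite -[in RHS]z1 -[in LHS]z2 !nth_mkseq //; exact: size_v.
exists x; first exact: (vx 0%N).
by move=> /MF[n _ Fx]; have [_] := (vS n).2 _ (vx n.+1); exact.
Qed.

End Baire.

(** * Averages of the expectation over cylinders and their limit *)

Section Average.
Variables (X : finType) (a0 : X) (G : self_similar_group X) (R : realType).
Local Notation Y := (infword X).
Local Notation P := (Kpseudogroup G).
Local Notation S := (pg_maps P).
Local Notation C := (Cx R).
Local Notation lift := (@germ_lift Y P R).
Local Notation K := (Kgroupoid G).
Implicit Types (s t : Y -> option Y) (u v w : seq X) (x z : Y) (f : Y -> C).
Variables (A : cstar_algebra R) (iota : (gp_arrow K -> C) -> A).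
Hypothesis full : is_full_cstar iota.
Hypothesis fin : forall g : G, finite_state (ss_act g).
Local Notation el := (bisection_elt iota).
Local Notation one := (el Some).
Variable E : A -> Y -> C.
Hypothesis expE : @is_expectation R K A iota E.

(** The limit estimates are uniform over samplers, so that a sampler can later be adapted to a given
    element of the singular ideal. *)
Definition sampler (y : seq X -> Y) := forall w, cylinder w (y w).

Definition average y n a : C := (\sum_(w <- words X n) E a (y w)) / (#|X| ^ n)%:R.

Lemma card_words_gt0 n : 0 < (#|X| ^ n)%:R :> C.
Proof. by rewrite ltr0n expn_gt0; apply/orP; left; apply/card_gt0P; exists a0. Qed.

Lemma average_linear y n c a b :
  average y n (c *: a + b) = c * average y n a + average y n b.
Proof.
have [_ El _ _ _] := expE; rewrite /average mulrA -mulrDl; congr (_ / _).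
by rewrite mulr_sumr -big_split; apply: eq_bigr => w _; rewrite El.
Qed.

Lemma norm_average_le y n a (F : seq X -> R) :
  (forall w, size w = n -> `|E a (y w)| <= toC (F w)) ->
  `|average y n a| <= toC ((\sum_(w <- words X n) F w) / (#|X| ^ n)%:R).
Proof.
move=> H; rewrite /average normrM normfV (ger0_norm (ltW (card_words_gt0 n))).
rewrite ler_pdivrMr ?card_words_gt0 // toCM toCV toC_nat divfK ?gt_eqF ?card_words_gt0 //.
apply: le_trans (ler_norm_sum _ _ _) _.
rewrite (big_morph (@toC R) (@toCD R) (@toC0 R)) !big_seq; apply: ler_sum => w.
by rewrite mem_words => /eqP /H.
Qed.

Lemma norm_average y n a : `|average y n a| <= `|a|.
Proof.
have [_ _ En _ _] := expE.
apply: le_trans (@norm_average_le y n a (fun=> rnorm a) _) _.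
  by move=> w _; rewrite -Re_norm ler_toC En.
rewrite big_const_seq count_predT iter_addr_0 size_words.
rewrite -[rnorm a *+ _]mulr_natr mulfK ?rnormE //.
by rewrite pnatr_eq0 -(pnatr_eq0 C) gt_eqF // card_words_gt0.
Qed.

Lemma E_el s x : S s -> E (el s) x = (`[< \forall y \near x, s y = Some y >])%:R.
Proof.
move=> Ss; have [_ _ _ _ Ei] := expE.
rewrite Ei; last exact: Cc_el.
by rewrite [LHS](germ_lift_unit _ _ Ss); case: ifP.
Qed.

Lemma fixing_near s w x : fixing s w -> cylinder w x -> \forall y \near x, s y = Some y.
Proof.
move=> /asboolP fw xw; apply/nbhs_infwordP; exists (size w) => y yx.
by apply: fw; rewrite /cylinder /= yx.
Qed.

Definition fixing_ratio s n : R := (count (fixing s) (words X n))%:R / (#|X| ^ n)%:R.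
Definition bad_ratio s n : R := (count (bad s) (words X n))%:R / (#|X| ^ n)%:R.

(** A fixing word contributes exactly 1, and a word that is not returning contributes 0, whatever
    the sample point. A bad word contributes 0 or 1. *)
Lemma average_el y s n : sampler y -> S s ->
  `|average y n (el s) - toC (fixing_ratio s n)| <= toC (bad_ratio s n).
Proof.
move=> yP Ss; rewrite /average /fixing_ratio /bad_ratio !toCM !toCV !toC_nat -mulrBl.
rewrite normrM normfV (ger0_norm (ltW (card_words_gt0 n))).
rewrite ler_pM2r ?invr_gt0 ?card_words_gt0 // !count_words_sum -sumrB.
apply: le_trans (ler_norm_sum _ _ _) _; apply: ler_sum => w _.
rewrite E_el //.
have [fw|nf] := boolP (fixing s w).
  by rewrite asboolT ?subrr ?normr0 //; exact: fixing_near fw (yP w).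
rewrite subr0 /bad nf /=.
have [rw|nr] := boolP (returning s w).
  by rewrite ger0_norm ?ler0n // ler_nat leq_b1.
rewrite asboolF ?normr0 // => /nbhs_singleton yw.
by move/asboolP: nr; apply; exists (y w), (y w); split=> //; exact: yP.
Qed.

Lemma bad_ratio_small s (e : R) : S s -> 0 < e -> exists N, forall n, (N <= n)%N ->
  bad_ratio s n <= e.
Proof.
move=> Ss e0; have [N NP] := bad_small a0 fin Ss e0; exists N => n /NP H.
rewrite /bad_ratio ler_pdivrMr //.
by have := card_words_gt0 n; rewrite -toC_nat toC_gt0.
Qed.

(** Only bad words leave a choice at deeper levels: every extension of a fixing word is fixing, and
    a word that is not returning has no fixing extension. *)
Lemma fixing_ratio_le s n m : (n <= m)%N ->
  `|fixing_ratio s m - fixing_ratio s n| <= bad_ratio s n.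
Proof.
have N0 k : 0 < (#|X| ^ k)%:R :> R by have := card_words_gt0 k; rewrite -toC_nat toC_gt0.
move=> /subnKC <-; set k := (m - n)%N.
have -> : fixing_ratio s n =
    (\sum_(w <- words X n) (fixing s w)%:R * (#|X| ^ k)%:R) / (#|X| ^ (n + k))%:R.
  rewrite /fixing_ratio count_words_sum -mulr_suml expnD natrM invfM mulrACA divff ?mulr1 //.
  by rewrite gt_eqF.
have -> : bad_ratio s n =
    (\sum_(w <- words X n) (bad s w)%:R * (#|X| ^ k)%:R) / (#|X| ^ (n + k))%:R.
  rewrite /bad_ratio count_words_sum -mulr_suml expnD natrM invfM mulrACA divff ?mulr1 //.
  by rewrite gt_eqF.
rewrite /fixing_ratio count_words_sum sum_words -mulrBl normrM normfV [`|_%:R|]ger0_norm //.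
rewrite ler_pM2r ?invr_gt0 // -sumrB.
apply: le_trans (ler_norm_sum _ _ _) _; apply: ler_sum => u _.
have sz c : c * (#|X| ^ k)%:R = \sum_(v <- words X k) c :> R.
  by rewrite big_const_seq count_predT iter_addr_0 size_words mulr_natr.
rewrite !sz -sumrB; apply: le_trans (ler_norm_sum _ _ _) _; apply: ler_sum => v _.
have [fu|nf] := boolP (fixing s u); first by rewrite fixing_cat // subrr normr0.
rewrite /bad nf subr0 ger0_norm ?ler0n // ler_nat.
have [//|nr] := boolP (returning s u); first by rewrite leq_b1.
rewrite leqn0 eqb0; apply: contra nr => /asboolP fuv; apply/asboolP.
have uv : cylinder (u ++ v) (infcat (u ++ v) (fun=> a0)).
  by rewrite /cylinder /= infcat_prefix.
exists (infcat (u ++ v) (fun=> a0)), (infcat (u ++ v) (fun=> a0)).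
by split; [exact: cylinder_cat uv|exact: fuv|exact: cylinder_cat uv].
Qed.

(** For 1_s this combines the two preceding estimates with [bad_ratio_small]. It passes to limits
    because averages are contractive, uniformly in the level and the sampler. *)
Lemma average_cauchy a (e : R) : 0 < e -> exists N, forall n m, (N <= n)%N -> (N <= m)%N ->
  forall y y', sampler y -> sampler y' -> `|average y n a - average y' m a| <= toC e.
Proof.
move: e; apply: (dense_ind a0 full (Q := fun a => forall e : R, 0 < e ->
  exists N, forall n m, (N <= n)%N -> (N <= m)%N ->
  forall y y', sampler y -> sampler y' -> `|average y n a - average y' m a| <= toC e)).
- move=> e e0; exists 0%N => n m _ _ y y' _ _.
  by rewrite !(functional0 (average_linear _ _)) subrr normr0 toC_ge0 ltW.
- move=> c b b' Hb Hb' e e0.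
  have c0 : 0 < complex.Re `|c| + 1 by rewrite ltr_wpDl // -toC_ge0 Re_norm.
  have [N NP] := Hb (e / 2 / (complex.Re `|c| + 1)) (divr_gt0 (divr_gt0 e0 (ltr0n _ 2)) c0).
  have [M MP] := Hb' (e / 2) (divr_gt0 e0 (ltr0n _ 2)).
  exists (maxn N M) => n m; rewrite !geq_max => /andP[Nn Mn] /andP[Nm Mm] y y' yP yP'.
  have Hn := NP _ _ Nn Nm _ _ yP yP'; have Hm := MP _ _ Mn Mm _ _ yP yP'.
  rewrite !average_linear.
  set p := average y n b in Hn *; set q := average y' m b in Hn *.
  set p' := average y n b' in Hm *; set q' := average y' m b' in Hm *.
  have -> : c * p + p' - (c * q + q') = c * (p - q) + (p' - q') by ring.
  apply: le_trans (ler_normD _ _) _; rewrite [e]splitr toCD; apply: lerD => //.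
  rewrite normrM -[in leRHS](divfK (lt0r_neq0 c0) (e / 2)) toCM [leRHS]mulrC.
  apply: ler_pM => //; rewrite toCD Re_norm toC1 lerDl ler01 //.
- move=> b Hb e e0; have e3 : 0 < e / 3 by rewrite divr_gt0.
  have [d Hd bd] := Hb _ e3; have [N NP] := Hd _ e3.
  exists N => n m Nn Nm y y' yP yP'; have H := NP _ _ Nn Nm _ _ yP yP'.
  have -> : average y n b - average y' m b = average y n (b - d) +
      (average y n d - average y' m d) - average y' m (b - d).
    by rewrite !(functionalB (average_linear _ _)); ring.
  have -> : toC e = toC (e / 3) + toC (e / 3) + toC (e / 3).
    by rewrite -!toCD; congr toC; field.
  apply: le_trans (ler_normB _ _) _; apply: lerD; last exact: le_trans (norm_average _ _ _) bd.
  apply: le_trans (ler_normD _ _) _; apply: lerD => //.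
  exact: le_trans (norm_average _ _ _) bd.
- move=> s Ss e e0; have e4 : 0 < e / 4 by rewrite divr_gt0.
  have [N NP] := bad_ratio_small Ss e4; exists N => n m Nn Nm y y' yP yP'.
  have H k (Nk : (N <= k)%N) (z : seq X -> Y) : sampler z ->
      `|average z k (el s) - toC (fixing_ratio s N)| <= toC (e / 2).
    move=> zP; rewrite -(subrKA (toC (fixing_ratio s k))).
    have -> : e / 2 = e / 4 + e / 4 by field.
    apply: le_trans (ler_normD _ _) _; rewrite toCD; apply: lerD.
      by apply: le_trans (average_el _ zP Ss) _; rewrite ler_toC NP.
    rewrite -toCN -toCD norm_toC ler_toC.
    by apply: le_trans (fixing_ratio_le s Nk) _; exact: NP.
  rewrite -(subrKA (toC (fixing_ratio s N))) [e]splitr toCD.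
  apply: le_trans (ler_normD _ _) _; apply: lerD; first exact: H.
  by rewrite distrC; exact: H.
Qed.

Definition average_limit a l := forall e : R, 0 < e -> exists N, forall n, (N <= n)%N ->
  forall y, sampler y -> `|average y n a - l| <= toC e.

Let y0 w : Y := infcat w (fun=> a0).

Let y0P : sampler y0.
Proof. by move=> w; rewrite /cylinder /y0 /= infcat_prefix. Qed.

Lemma average_limit_ex a : exists l, average_limit a l.
Proof.
have [|l lP] := @complex_cauchy R (fun n => average y0 n a).
  move=> e /(average_cauchy a)[N NP]; exists N => n m Nn Nm.
  exact: (NP _ _ Nn Nm _ _ y0P y0P).
exists l => e e0; have e2 : 0 < e / 2 by rewrite divr_gt0.
have [N NP] := lP _ e2; have [M MP] := average_cauchy a e2.
exists (maxn N M) => n; rewrite geq_max => /andP[Nn Mn] y yP.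
rewrite -(subrKA (average y0 n a)) [e]splitr toCD.
by apply: le_trans (ler_normD _ _) _; apply: lerD; [exact: MP|exact: NP].
Qed.

Definition tau a : C := projT1 (cid (average_limit_ex a)).

Lemma tauP a : average_limit a (tau a).
Proof. exact: (projT2 (cid (average_limit_ex a))). Qed.

Lemma average_limit_unique a l l' : average_limit a l -> average_limit a l' -> l = l'.
Proof.
move=> H H'; apply/eqP; rewrite -subr_eq0; apply/eqP/norm_le_eps => e e0.
have e2 : 0 < e / 2 by rewrite divr_gt0.
have [N NP] := H _ e2; have [M MP] := H' _ e2.
have hn := NP _ (leq_maxl N M) _ y0P; have hm := MP _ (leq_maxr N M) _ y0P.
rewrite -(subrKA (average y0 (maxn N M) a)) [e]splitr toCD.
by apply: le_trans (ler_normD _ _) _; apply: lerD; rewrite // distrC.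
Qed.

Lemma tau_linear c a b : tau (c *: a + b) = c * tau a + tau b.
Proof.
apply: (average_limit_unique (tauP _)) => e e0.
have c0 : 0 < complex.Re `|c| + 1 by rewrite ltr_wpDl // -toC_ge0 Re_norm.
have [N NP] := tauP a (divr_gt0 (divr_gt0 e0 (ltr0n _ 2)) c0).
have [M MP] := tauP b (divr_gt0 e0 (ltr0n _ 2)).
exists (maxn N M) => n; rewrite !geq_max => /andP[Nn Mn] y yP.
have Hn := NP _ Nn _ yP; have Hm := MP _ Mn _ yP.
rewrite average_linear.
set p := average y n a in Hn *; set p' := average y n b in Hm *.
have -> : c * p + p' - (c * tau a + tau b) = c * (p - tau a) + (p' - tau b) by ring.
apply: le_trans (ler_normD _ _) _; rewrite [e]splitr toCD; apply: lerD => //.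
rewrite normrM -[in leRHS](divfK (lt0r_neq0 c0) (e / 2)) toCM [leRHS]mulrC.
by apply: ler_pM => //; rewrite toCD Re_norm toC1 lerDl ler01.
Qed.

Lemma tau_approx a (e : R) : 0 < e -> exists n, `|average y0 n a - tau a| <= toC e.
Proof. by move=> /(tauP a)[N NP]; exists N; exact: (NP _ (leqnn N) _ y0P). Qed.

Lemma norm_tau a : `|tau a| <= `|a|.
Proof.
rewrite -[leLHS]Re_norm -[leRHS]rnormE ler_toC; apply/ler_addgt0Pr => e e0.
rewrite -ler_toC Re_norm toCD rnormE.
have [n H] := tau_approx a e0.
have -> : tau a = average y0 n a - (average y0 n a - tau a) by ring.
apply: le_trans (ler_normB _ _) _; apply: lerD => //; exact: norm_average.
Qed.

Lemma tau_ge0 a : 0 <= tau (cs_mul (cs_star a) a).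
Proof.
have [_ _ _ Ep _] := expE.
apply: limit_ge0 => e /(tau_approx (cs_mul (cs_star a) a))[n H].
exists (average y0 n (cs_mul (cs_star a) a)) => //.
by rewrite divr_ge0 ?ler0n // sumr_ge0.
Qed.

Lemma tau_one : tau one = 1.
Proof.
apply: (average_limit_unique (tauP _)) => e e0; exists 0%N => n _ y _.
rewrite /average (eq_bigr (fun=> 1)) => [|w _].
  rewrite big_const_seq count_predT iter_addr_0 size_words divff.
    by rewrite subrr normr0 toC_ge0 ltW.
  by rewrite gt_eqF // card_words_gt0.
by rewrite E_el; [rewrite asboolT //; exact: filterE|exact: Kmaps_id].
Qed.

(** At a common large level the two fixing ratios are equal, since [count_fixing_comp] applies in
    both directions; both sides are close to this ratio. *)
Lemma tau_el_comm s t : S s -> S t -> tau (el (pcomp s t)) = tau (el (pcomp t s)).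
Proof.
move=> Ss St; have Sst := pg_comp St Ss; have Sts := pg_comp Ss St.
apply/eqP; rewrite -subr_eq0; apply/eqP/norm_le_eps => e e0.
have e4 : 0 < e / 4 by rewrite divr_gt0.
have [N1 H1] := count_fixing_comp a0 Ss St; have [N2 H2] := count_fixing_comp a0 St Ss.
have [N3 H3] := bad_ratio_small Sst e4; have [N4 H4] := bad_ratio_small Sts e4.
have [N5 H5] := tauP (el (pcomp s t)) e4; have [N6 H6] := tauP (el (pcomp t s)) e4.
pose n := (N1 + N2 + N3 + N4 + N5 + N6)%N.
have cE : fixing_ratio (pcomp s t) n = fixing_ratio (pcomp t s) n.
  congr (_%:R / _); apply/eqP; rewrite eqn_leq H1 ?H2 //; rewrite /n; lia.
have {}H3 : bad_ratio (pcomp s t) n <= e / 4 by apply: H3; rewrite /n; lia.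
have {}H4 : bad_ratio (pcomp t s) n <= e / 4 by apply: H4; rewrite /n; lia.
have {}H5 : `|average y0 n (el (pcomp s t)) - tau (el (pcomp s t))| <= toC (e / 4).
  by apply: H5 y0P; rewrite /n; lia.
have {}H6 : `|average y0 n (el (pcomp t s)) - tau (el (pcomp t s))| <= toC (e / 4).
  by apply: H6 y0P; rewrite /n; lia.
have H7 := average_el n y0P Sst; have H8 := average_el n y0P Sts.
rewrite -cE in H8.
set p := average _ _ _ in H5 H7; set q := average _ _ _ in H6 H8.
set f := toC (fixing_ratio _ _) in H7 H8.
have -> : tau (el (pcomp s t)) - tau (el (pcomp t s)) =
  ((q - tau (el (pcomp t s))) - (p - tau (el (pcomp s t)))) + ((p - f) - (q - f)) by ring.
have -> : toC e = (toC (e / 4) + toC (e / 4)) + (toC (e / 4) + toC (e / 4)).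
  by rewrite -!toCD; congr toC; field.
apply: le_trans (ler_normD _ _) _; apply: lerD.
  by apply: le_trans (ler_normB _ _) _; exact: lerD.
apply: le_trans (ler_normB _ _) _; apply: lerD.
  by apply: le_trans H7 _; rewrite ler_toC.
by apply: le_trans H8 _; rewrite ler_toC.
Qed.

(** Both sides are bounded and linear in each variable, so the identity extends from the 1_s by
    density, one variable at a time. *)
Lemma tau_trace a b : tau (cs_mul a b) = tau (cs_mul b a).
Proof.
have M0 (d : A) : 0 < rnorm d + 1 by rewrite ltr_wpDl // -toC_ge0 rnormE.
have bl (d c : A) : `|tau (cs_mul d c)| <= toC (rnorm d + 1) * `|c|.
  apply: le_trans (norm_tau _) _; apply: le_trans (cs_normM _ _) _.
  by rewrite ler_wpM2r // toCD rnormE toC1 lerDl ler01.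
have br (d c : A) : `|tau (cs_mul c d)| <= toC (rnorm d + 1) * `|c|.
  apply: le_trans (norm_tau _) _; apply: le_trans (cs_normM _ _) _.
  by rewrite mulrC ler_wpM2r // toCD rnormE toC1 lerDl ler01.
have ll (d : A) k c c' : tau (cs_mul d (k *: c + c')) = k * tau (cs_mul d c) + tau (cs_mul d c').
  by rewrite cs_mulDr cs_mulZr tau_linear.
have lr (d : A) k c c' : tau (cs_mul (k *: c + c') d) = k * tau (cs_mul c d) + tau (cs_mul c' d).
  by rewrite cs_mulDl cs_mulZl tau_linear.
have tr_el s (Ss : S s) d : tau (cs_mul (el s) d) = tau (cs_mul d (el s)).
  apply: (functional_ext a0 full (F := fun c => tau (cs_mul (el s) c))
    (F' := fun c => tau (cs_mul c (el s))) (M0 (el s)) (ll _) (lr _) (bl _) (br _)).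
  by move=> t St; rewrite !el_mul //; exact: tau_el_comm.
apply: (functional_ext a0 full (F := fun c => tau (cs_mul c b))
  (F' := fun c => tau (cs_mul b c)) (M0 b) (lr b) (ll b) (br b) (bl b)) => s Ss.
exact: tr_el.
Qed.

Lemma tau_singular a : @singular_ideal R K A E a -> tau a = 0.
Proof.
move=> Ja.
have /choice[y yP] w : exists x : Y, cylinder w x /\ E (cs_mul (cs_star a) a) x = 0.
  by have [x xw /contrapT nx] := meagre_cylinder a0 w Ja; exists x.
(* A Cauchy-Schwarz argument against the unit passes from a^* a to a itself, as is required for tau
   to factor through the quotient. *)
apply: (functional_null tau_linear tau_ge0 (one := one)).
- exact: el_one_star.
- exact: el_one_mul.
- exact: el_one_mul.
- exact: el_mul_one.
apply: norm_le_eps => e e0.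
have [N NP] := tauP (cs_mul (cs_star a) a) e0.
have := NP N (leqnn N) y (fun w => (yP w).1).
rewrite /average big1 ?mul0r ?sub0r ?normrN // => w _; exact: (yP w).2.
Qed.

End Average.

(** * Uniqueness *)

Section Uniqueness.
Variables (X : finType) (a0 : X) (G : self_similar_group X) (R : realType).
Local Notation Y := (infword X).
Local Notation S := (pg_maps (Kpseudogroup G)).
Local Notation C := (Cx R).
Variables (A : cstar_algebra R) (iota : (gp_arrow (Kgroupoid G) -> C) -> A).
Hypothesis full : is_full_cstar iota.
Hypothesis fin : forall g : G, finite_state (ss_act g).
Local Notation one := (bisection_elt iota Some).

(** The factor sigma(1) stays open because a functional of norm one is not yet known to take the
    value 1 at the unit; that value is derived afterwards from the proportionality. *)
Lemma trace_unique_scaled (sigma rho : A -> C) :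
  (forall c a b, sigma (c *: a + b) = c * sigma a + sigma b) ->
  (forall c a b, rho (c *: a + b) = c * rho a + rho b) ->
  (forall a, 0 <= sigma (cs_mul (cs_star a) a)) ->
  (forall a, 0 <= rho (cs_mul (cs_star a) a)) ->
  (forall a b, sigma (cs_mul a b) = sigma (cs_mul b a)) ->
  (forall a b, rho (cs_mul a b) = rho (cs_mul b a)) ->
  (forall a, `|sigma a| <= `|a|) -> (forall a, `|rho a| <= `|a|) ->
  rho one = 1 -> forall a, sigma a = sigma one * rho a.
Proof.
move=> ls lr ps pr ts tr bs br r1.
have n1 : `|one| <= 1 by apply: (norm_el full); exact: Kmaps_id.
have s1 : 0 <= sigma one.
  by have := ps one; rewrite (el_one_star full) (el_one_mul a0 full).
apply: (functional_ext a0 full (F := sigma) (F' := fun a => sigma one * rho a) ltr01) => //.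
- by move=> c a b; rewrite lr; ring.
- by move=> a; rewrite toC1 mul1r.
- move=> a; rewrite toC1 normrM; apply: ler_pM => //.
  exact: le_trans (bs _) n1.
move=> s Ss; apply/eqP; rewrite -subr_eq0; apply/eqP/norm_le_eps => e e0.
(* Each bad word costs 2 sigma(1) in the estimate for sigma and another 2 sigma(1) in the one for
   rho scaled by sigma(1); the added 1 keeps k positive. *)
pose k : R := 4 * (complex.Re (sigma one) + 1).
have k0 : 0 < k by rewrite mulr_gt0 // ltr_wpDl // -toC_ge0 Re_ge0.
have [N1 H1] := trace_el full ls ps ts Ss.
have [N2 H2] := trace_el full lr pr tr Ss.
have [N3 H3] := bad_small a0 fin Ss (divr_gt0 e0 k0).
pose n := (N1 + N2 + N3)%N.
have {}H1 := H1 n (leq_trans (leq_addr _ _) (leq_addr _ _)).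
have {}H2 := H2 n (leq_trans (leq_addl _ _) (leq_addr _ _)).
have {}H3 := H3 n (leq_addl _ _).
have Xn := card_words_gt0 a0 R n.
rewrite -(ler_pM2r Xn) -[X in _ * X <= _](ger0_norm (ltW Xn)) -normrM.
move: H1 H2 H3; rewrite r1 !mul1r mulr1.
set f := (count (fixing s) _)%:R; set b := (count (bad s) _)%:R.
set b' := (count (bad s) _)%:R => H1 H2 H3.
set x := sigma (bisection_elt iota s) in H1 *; set y := rho (bisection_elt iota s) in H2 *.
have -> : (x - sigma one * y) * (#|X| ^ n)%:R = (x * (#|X| ^ n)%:R - sigma one * f) -
   sigma one * (y * (#|X| ^ n)%:R - f) by ring.
apply: le_trans (ler_normB _ _) _; rewrite normrM (ger0_norm s1).
apply: le_trans (lerD H1 (ler_wpM2l s1 H2)) _.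
have bE : b = toC b' by rewrite /b /b' toC_nat.
have -> : 2 * sigma one * b + sigma one * (2 * b) = toC (4 * complex.Re (sigma one)) * b.
  by rewrite toCM toC_nat Re_ge0 //; ring.
rewrite bE -toC_nat -!toCM ler_toC.
apply: le_trans (_ : k * b' <= _).
  by rewrite ler_wpM2r ?ler0n // /k mulrDr lerDl.
by apply: le_trans (ler_wpM2l (ltW k0) H3) _; rewrite mulrA [k * _]mulrC divfK // gt_eqF.
Qed.

End Uniqueness.

(** The value 1 rules out the convention that a set without supremum has [sup] 0, so the unit ball
    has a genuine bound, and b can be rescaled into it. *)
Lemma state_bounded (R : realType) (B : cstar_algebra R) (tau : B -> Cx R) :
  is_state tau -> forall b, `|tau b| <= `|b|.
Proof.
move=> [lin _ sup1] b.
have [->|b0] := eqVneq b 0; first by rewrite (functional0 lin) !normr0.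
have r0 : 0 < rnorm b by rewrite -toC_gt0 rnormE normr_gt0.
have i0 : 0 < (rnorm b)^-1 by rewrite invr_gt0.
have hs : has_sup [set complex.Re `|tau a| | a in [set a : B | rnorm a <= 1]].
  apply: contrapT => /sup_out e; move: sup1; rewrite e => /esym/eqP.
  by rewrite oner_eq0.
have := ub_le_sup hs.2 (_ : [set complex.Re `|tau a| | a in [set a : B | rnorm a <= 1]]
  (complex.Re `|tau (toC (rnorm b)^-1 *: b)|)).
rewrite sup1 => H.
have : complex.Re `|tau (toC (rnorm b)^-1 *: b)| <= 1.
  apply: H; exists (toC (rnorm b)^-1 *: b) => //=.
  rewrite -ler_toC rnormE normrZ norm_toC (gtr0_norm i0) -rnormE -toCM.
  by rewrite mulVf ?gt_eqF.
rewrite -ler_toC Re_norm (functionalZ lin) normrM norm_toC (gtr0_norm i0).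
rewrite toCV toC1 mulrC ler_pdivrMr ?toC_gt0 // mul1r rnormE.
by [].
Qed.

Theorem corollary6p3 (R : realType) (X : finType) (G : self_similar_group X)
    (hX : (2 <= #|X|)%N)
    (hG : forall g : G, finite_state (ss_act g))
    (B : cstar_algebra R) (hB : is_essential_cstar (Kgroupoid G) B) :
  exists! tau : B -> Cx R, is_tracial_state tau.
Proof.
have /card_gt0P[a0 _] : (0 < #|X|)%N by apply: leq_trans hX.
case: hB => A [iota [E [q [full expE [ql qM qS [qsurj qker] qnorm]]]]].
pose one := bisection_elt iota Some; pose tau := tau a0 full hG expE.
have n1 : `|one| <= 1 by apply: (norm_el full); exact: Kmaps_id.
have tl : forall c a b, tau (c *: a + b) = c * tau a + tau b by exact: tau_linear.
have t1 : tau one = 1 by exact: tau_one.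
have q0 : q 0 = 0.
  have /(congr1 (fun b : B => b - q 0)) := ql 1 0 0.
  by rewrite !scale1r addr0 addrK subrr => <-.
have norm_q a : `|q a| <= `|a|.
  rewrite -!rnormE ler_toC qnorm -[leRHS](congr1 (@rnorm _ _) (addr0 a)).
  apply: ge_inf; last by exists 0 => //; apply/qker.
  by exists 0 => _ [j _ <-]; rewrite -toC_ge0 rnormE.
(* Any set-theoretic section of q will do: two preimages of a point differ by an element of the
   singular ideal, where tau vanishes. *)
have [g gK] := choice qsurj.
pose tauB b := tau (g b).
have tauBq a : tauB (q a) = tau a.
  have : tau (- 1 *: a + g (q a)) = 0.
    by apply: tau_singular; apply/qker; rewrite ql gK scaleN1r addrC subrr.
  by rewrite tl mulN1r addrC => /eqP; rewrite subr_eq0 => /eqP.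
(* The quotient norm is an infimum over a coset, on which tau is constant and contractive. *)
have tauB_le b : `|tauB b| <= `|b|.
  rewrite -[leLHS]Re_norm -[leRHS]rnormE ler_toC -[b in rnorm b]gK qnorm.
  apply: lb_le_inf; first by exists (rnorm (g b + 0)), 0 => //; apply/qker.
  move=> _ [j /= Jj <-]; rewrite -ler_toC Re_norm rnormE.
  rewrite -[tauB b]addr0 -(tau_singular a0 full hG expE Jj) -(functionalD tl).
  exact: norm_tau.
have tracial : is_tracial_state tauB.
  split; last first.
    by move=> a b; rewrite -(gK a) -(gK b) -!qM !tauBq; exact: tau_trace.
  split.
  - by move=> c a b; rewrite -(gK a) -(gK b) -ql !tauBq.
  - by move=> a; rewrite -(gK a) -qS -qM tauBq; exact: tau_ge0.
  (* Contractivity bounds the norm by 1, and the bound is attained at the image of the unit. *)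
  set D := [set _ | _ in _].
  have ubD : ubound D 1.
    move=> _ [b /= b1 <-]; apply: le_trans b1.
    by rewrite -ler_toC Re_norm rnormE.
  have D1 : D 1.
    exists (q one); last by rewrite tauBq t1 normr1.
    by rewrite /= -ler_toC rnormE toC1; apply: le_trans (norm_q _) n1.
  apply/eqP; rewrite eq_le; apply/andP; split.
    by apply: ge_sup => //; exists 1.
  by apply: ub_le_sup => //; exists 1.
exists tauB; split=> // tau' [st' tr'].
have [l' p' sup'] := st'; have b' := state_bounded st'.
pose sigma a := tau' (q a).
have sE a : sigma a = sigma one * tau a.
  apply: (trace_unique_scaled a0 full hG).
  - by move=> c d d'; rewrite /sigma ql l'.
  - exact: tl.
  - by move=> d; rewrite /sigma qM qS.
  - exact: tau_ge0.
  - by move=> d d'; rewrite /sigma !qM tr'.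
  - exact: tau_trace.
  - by move=> d; apply: le_trans (b' _) (norm_q _).
  - exact: norm_tau.
  - exact: t1.
have s0 : 0 <= sigma one.
  have := p' (q one); rewrite -qS -qM (el_one_star full) (el_one_mul a0 full).
  exact.
have s1 : sigma one = 1.
  apply/eqP; rewrite eq_le; apply/andP; split.
    rewrite -[leLHS](ger0_norm s0); apply: le_trans (b' _) _.
    exact: le_trans (norm_q _) n1.
  (* As sigma(1) times a contractive functional, [tau'] has norm at most sigma(1); its norm is 1, so
     sigma(1) is at least 1. *)
  rewrite -[leRHS](Re_ge0 s0) -(toC1 R) ler_toC -sup'.
  apply: ge_sup.
    by exists (complex.Re `|tau' 0|), 0; rewrite //= -ler_toC rnormE normr0 toC1 ler01.
  move=> _ [b /= b1 <-]; rewrite -ler_toC Re_norm Re_ge0 //.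
  rewrite -(gK b) -/(sigma _) sE normrM (ger0_norm s0) -[leRHS]mulr1 ler_wpM2l //.
  apply: le_trans (tauB_le b) _; by rewrite -rnormE -(toC1 R) ler_toC.
by apply/funext => b; rewrite -(gK b) tauBq -/(sigma _) sE s1 mul1r.
Qed.
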